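(* Assume $\Omega$ is compact and let $f$ be a left interval-specification on $(\Omega,\mathcal{F})$ that is continuous and with a unique consistent measure. Let $\mu$ be the unique probability measure in $\mathcal{G}(f)$. Then for every $\Lambda,\Delta\in\mathcal{S}_b$ such that $m_\Delta<l_\Lambda$, $$\mathrm{Cor}_\mu(h_1,h_2)\;\le\;\frac{D^2}{4}\sum_{k\le m_\Delta}\delta_k^d\bigl(f_{[k+1,m_\Lambda]}h_1\bigr)\,\delta_k^d\bigl(f_{[k+1,m_\Delta]}h_2\bigr)$$ for all functions $h_1\in\mathcal{B}_d(\Lambda)$ and $h_2\in\mathcal{B}_d(]-\infty,m_\Delta])$.
   Context: Let $E$ be a set with a bounded distance $d$, $\mathcal{E}$ its Borel $\sigma$-algebra, and $D=\sup_{x,y\in E}d(x,y)$. Let $\Omega\subset E^{\mathbb{Z}}$ be a set of (admissible) configurations, endowed with the restriction of the product topology and with the restriction $\mathcal{F}$ of the product $\sigma$-algebra. For $\Lambda\subset\mathbb{Z}$, $\Omega_\Lambda=\{\sigma_\Lambda\in E^\Lambda:\exists\,\omega\in\Omega\text{ with }\omega_\Lambda=\sigma_\Lambda\}$, where $\omega_\Lambda=(\omega_i)_{i\in\Lambda}$; $\Omega_{-\infty}^{i}=\Omega_{]-\infty,i]}$; $\mathcal{F}_\Lambda\subset\mathcal{F}$ is the $\sigma$-algebra generated by the cylinders with base in $\Omega_\Lambda$; $\mathcal{F}_{\le n}=\mathcal{F}_{]-\infty,n]}$. $\mathcal{S}_b$ is the set of finite intervals of $\mathbb{Z}$; for $\Lambda\in\mathcal{S}_b$,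 $l_\Lambda=\min\Lambda$, $m_\Lambda=\max\Lambda$, $\Lambda_-=\,]-\infty,l_\Lambda-1]$. A left interval-specification (LIS) on $(\Omega,\mathcal{F})$ is a family $f=\{f_\Lambda\}_{\Lambda\in\mathcal{S}_b}$ of probability kernels $f_\Lambda:\mathcal{F}_{\le m_\Lambda}\times\Omega\to[0,1]$ such that for all $\Lambda\in\mathcal{S}_b$: (a) for each $A\in\mathcal{F}_{\le m_\Lambda}$, $f_\Lambda(A\mid\cdot)$ is $\mathcal{F}_{\Lambda_-}$-measurable; (b) for each $B\in\mathcal{F}_{\Lambda_-}$ and $\omega\in\Omega$, $f_\Lambda(B\mid\omega)=\mathbf{1}_B(\omega)$; (c) for each $\Delta\in\mathcal{S}_b$ with $\Delta\supset\Lambda$, $f_\Delta f_\Lambda=f_\Delta$ on $\mathcal{F}_{\le m_\Lambda}$, i.e. $\int\!\int h(\xi)f_\Lambda(d\xi\mid\sigma)f_\Delta(d\sigma\mid\omega)=\int h(\sigma)f_\Delta(d\sigma\mid\omega)$ for each $\mathcal{F}_{\le m_\Lambda}$-measurable $h$ and each $\omega\in\Omega$. We write $(f_\Lambda h)(\omega)=\int h(\sigma)f_\Lambda(d\sigma\mid\omega)$, and $f_{[m+1,m]}h=h$. The LIS is continuous if $\Omega\ni\omega\mapsto f_\Lambda(A\mid\omega)$ is continuous for all $\Lambda\in\mathcal{S}_b$ and $A\in\mathcal{F}_\Lambda$. A probability measure $\mu$ on $(\Omega,\mathcal{F})$ is consistent with $f$ if $\mu f_\Lambda=\mu$ on $\mathcal{F}_{\le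 m_\Lambda}$ for every $\Lambda\in\mathcal{S}_b$, where $(\mu f_\Lambda)(A)=\int f_\Lambda(A\mid\omega)\mu(d\omega)$; $\mathcal{G}(f)$ is the set of such measures, and $\mu(h)=\int h\,d\mu$. For an $\mathcal{F}_{\le i}$-measurable function $h$ and $j\le i$, the $d$-oscillation of $h$ with respect to the site $j$ is $$\delta_j^d(h)=\sup\Bigl\{\tfrac{|h(\xi)-h(\eta)|}{d(\xi_j,\eta_j)}:\xi,\eta\in\Omega_{-\infty}^{i},\ \xi_k=\eta_k\ \forall k\ne j\Bigr\},\qquad 0/0=0.$$ $\mathcal{B}_d$ is the set of $\mathcal{F}$-measurable $h$ with $\sup_{j\in\mathbb{Z}}\delta^d_j(h)<\infty$, and for $\Lambda\subset\mathbb{Z}$, $\mathcal{B}_d(\Lambda)$ is the set of $\mathcal{F}_\Lambda$-measurable $h\in\mathcal{B}_d$. $\mathrm{Cor}_\mu(h_1,h_2)=|\mu(h_1h_2)-\mu(h_1)\mu(h_2)|$. *)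

(* Defs.v *)
(* MathComp / MathComp-Analysis. *)
From HB Require Import structures.
From mathcomp Require Import all_boot all_order all_algebra.
From mathcomp Require Import all_classical all_reals all_analysis.
From mathcomp Require Import measurable_realfun.

Set Implicit Arguments.
Unset Strict Implicit.
Unset Printing Implicit Defensive.

Import Order.TTheory GRing.Theory Num.Theory.
Import numFieldNormedType.Exports.

Local Open Scope classical_set_scope.
Local Open Scope ring_scope.

Section configurations.
Context {R : realType} {E : metricType R}.

Definition dists : set R := range (fun x : E * E => mdist x.1 x.2).

Definition diam : R := sup dists.

(* Measurable types are pointed in the library, hence the base point [w0]. It
   only records that [Omega] is nonempty, which is automatic as soon as
   [Omega] carries a probability measure. *)
Definition conf (Omega : set {ptws int -> E}) (w0 : Omega) : Type :=
  set_type Omega.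

End configurations.

Arguments dists {R} E.
Arguments diam {R} E.

HB.instance Definition _ (R : realType) (E : metricType R)
    (Omega : set {ptws int -> E}) (w0 : Omega) :=
  Choice.copy (conf w0) (set_type Omega).

HB.instance Definition _ (R : realType) (E : metricType R)
    (Omega : set {ptws int -> E}) (w0 : Omega) :=
  isPointed.Build (conf w0) w0.

(* The topology of the subtype: initial topology of the inclusion of [Omega]
   into the product space. *)
HB.instance Definition _ (R : realType) (E : metricType R)
    (Omega : set {ptws int -> E}) (w0 : Omega) :=
  Topological.copy (conf w0) (set_type Omega).

Section sigma_algebras.
Context {R : realType} {E : metricType R} {Omega : set {ptws int -> E}}.
Variable w0 : Omega.

Definition coord (i : int) (w : conf w0) : E := (\val w : {ptws int -> E}) i.

(* Cylinders over one site of [L] with Borel base; they generate the same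
   sigma-algebra as all the cylinders with base in [L]. *)
Definition cyl (L : set int) : set (set (conf w0)) :=
  [set C | exists i (A : set E),
     [/\ L i, <<s @open E >> A & C = coord i @^-1` A]].

(* [cfg L] is the configuration space with the sigma-algebra F_L, and
   [cfg setT] is the configuration space with F. All of them have the same
   carrier [conf w0], up to conversion. *)
Definition cfg (L : set int) := g_sigma_algebraType (cyl L).

(* For [h] measurable with respect to F_V this is
     sup { |h xi - h eta| / d (xi_j, eta_j) : xi, eta in Omega_V,
           xi_k = eta_k for all k <> j },
   where an element of Omega_V is represented by any configuration extending
   it; [V = ]-oo, i]] gives the oscillation of an F_{<= i}-measurable function.
   The convention 0 / 0 = 0 is that of the library. *)
Definition osc (V : set int) (j : int) (h : conf w0 -> R) : \bar R :=
  ereal_sup [set r | exists xi eta : conf w0,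
    (forall k, V k -> k != j -> coord k xi = coord k eta) /\
    r = (`|h xi - h eta| / mdist (coord j xi) (coord j eta))%:E].

Definition Bd (h : conf w0 -> R) : Prop :=
  measurable_fun [set: cfg setT] (h : cfg setT -> R) /\
  (ereal_sup (range (fun j : int => osc setT j h)) < +oo)%E.

Definition Bd_on (L : set int) (h : conf w0 -> R) : Prop :=
  Bd h /\ measurable_fun [set: cfg L] (h : cfg L -> R).

(* The interval [[l, m]] of Z is encoded by its endpoints; only the kernels
   with [l <= m] are constrained and used. Condition (a) of the definition of
   a left interval-specification is the measurability built into [R.-pker].
   In [lis_consistent], [[l, m]] is included in [[l', m']]. *)
Record lis := Lis {
  lis_ker :> forall l m : int,
    R.-pker (cfg `]-oo, (l - 1)]) ~> (cfg `]-oo, m]);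
  lis_proper : forall (l m : int), l <= m ->
    forall B : set (conf w0), measurable (B : set (cfg `]-oo, (l - 1)])) ->
    forall w : conf w0, lis_ker l m w B = (\1_B w)%:E;
  lis_consistent : forall (l m l' m' : int), l <= m -> l' <= l -> m <= m' ->
    forall h : conf w0 -> \bar R,
    measurable_fun [set: cfg `]-oo, m]] (h : cfg `]-oo, m] -> \bar R) ->
    (forall w, (0 <= h w)%E) ->
    forall w : conf w0,
    (\int[lis_ker l' m' w]_s (\int[lis_ker l m s]_x h x)
     = \int[lis_ker l' m' w]_s h s)%E
}.

(* [lis_app f l m h] is f_{[l, m]} h, with f_{[m + 1, m]} h = h. *)
Definition lis_app (f : lis) (l m : int) (h : conf w0 -> R) (w : conf w0) : R :=
  if l <= m then \int[f l m w]_s h s else h w.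

Definition lis_continuous (f : lis) : Prop :=
  forall l m : int, l <= m -> forall A : set (conf w0),
  measurable (A : set (cfg `[l, m])) ->
  continuous (fun w : conf w0 => fine (f l m w A) : R).

(* Membership in G(f). *)
Definition lis_measure (f : lis) (mu : probability (cfg setT) R) : Prop :=
  forall l m : int, l <= m -> forall A : set (conf w0),
  measurable (A : set (cfg `]-oo, m])) ->
  (\int[mu]_w f l m w A = mu A)%E.

Definition lis_unique_measure (f : lis) (mu : probability (cfg setT) R) :
    Prop :=
  lis_measure f mu /\
  forall nu : probability (cfg setT) R, lis_measure f nu ->
  forall A : set (cfg setT), measurable A -> nu A = mu A.

Definition Cor (mu : probability (cfg setT) R) (h1 h2 : conf w0 -> R) : R :=
  `| \int[mu]_w (h1 w * h2 w) - (\int[mu]_w h1 w) * (\int[mu]_w h2 w) |.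

End sigma_algebras.

Arguments cfg {R E Omega} w0 L.
Arguments lis {R E Omega} w0.

(* Main.v *)
Require Import Defs.
From HB Require Import structures.
From mathcomp Require Import all_boot all_order all_algebra.
From mathcomp Require Import all_classical all_reals all_analysis.
From mathcomp Require Import measurable_realfun zify ring lra.

Set Implicit Arguments.
Unset Strict Implicit.
Unset Printing Implicit Defensive.

Import Order.TTheory GRing.Theory Num.Theory.
Import numFieldNormedType.Exports.

Local Open Scope classical_set_scope.
Local Open Scope ring_scope.

(** Write P_l for the kernel of the interval [[l, mL]].  The covariance of h1
    and h2 under P_l (w) is controlled first, uniformly in w, and l is
    then sent to -oo.

    Finite volume.  By consistency, P_(j) = P_(j) P_(j+1), so that the
    covariance of h1 and h2 under P_(j) (w) is the mean under P_(j) (w) of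
    their covariance under P_(j+1), plus the covariance under P_(j) (w) of the
    two functions P_(j+1) h1 and P_(j+1) h2.  Those functions are measurable
    with respect to the sites up to j, while properness freezes the sites
    before j under P_(j) (w): only the site j moves, so that each of them has
    a spread of at most D times its oscillation at j, and two random variables
    of spreads a and b have a covariance of at most a b / 4.  The recursion
    starts at j = mD + 1, where h2 itself is frozen and the covariance is
    zero.  This is [finite_volume_covariance].

    Infinite volume.  It remains to show that P_l h tends to mu(h) in L^1(mu)
    as l goes to -oo, for every integrable h ([lis_avg_integrable_cvg]), since
    then some w makes P_l (h1 h2), P_l h1 and P_l h2 simultaneously close to
    their mu-means.  The convergence expresses that mu is trivial on the left
    tail, and uniqueness enters here.  For phi with values in [[0, 1]], the
    functions 1 + P_l phi - mu(phi) are probability densities bounded by 2.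
    Along an ultrafilter of indices the corresponding probabilities converge
    on every event, and the domination by 2 mu makes the limit countably
    additive ([ultralimit_probability]).  The density attached to l does not
    see the sites from l on, so the limit is consistent with f, and is thus
    mu itself.  Testing this identity on phi gives
    mu((P_l phi)^2) -> mu(phi)^2, which is convergence in L^2; truncation then
    passes from bounded to integrable functions.

    The random variables h1 and h2 are merely integrable.  This is why the
    argument goes through their covariance under P_l (w), which is bounded for
    almost every w, and through convergence in measure, rather than through the
    covariance of P_l h1 and P_l h2 under mu. *)

(** * Integrals with respect to a probability measure *)

Section probability_integrals.
Context {d : measure_display} {T : measurableType d} {R : realType}.
Variable P : {measure set T -> \bar R}.
Hypothesis P1 : P [set: T] = 1%E.

Lemma bounded_integrable (f : T -> R) (C : R) :
  measurable_fun [set: T] f -> (forall x, `|f x| <= C) ->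
  P.-integrable [set: T] (EFin \o f).
Proof.
move=> mf fC; apply: measurable_bounded_integrable => //.
  by rewrite P1 ltry.
exists C; split; first exact: num_real.
by move=> M CM x _; apply: le_trans (fC x) (ltW CM).
Qed.

Lemma cst_integrable (c : R) : P.-integrable [set: T] (EFin \o cst c).
Proof. exact: (@bounded_integrable _ `|c|). Qed.

Lemma Rintegral_prob_cst (c : R) : \int[P]_x c = c.
Proof. by rewrite Rintegral_cst// P1 mulr1. Qed.

Lemma ae_Rintegral (f g : T -> R) :
  measurable_fun [set: T] f -> measurable_fun [set: T] g ->
  (\forall x \ae P, f x = g x) -> \int[P]_x f x = \int[P]_x g x.
Proof.
move=> mf mg fg; congr fine; apply: ae_eq_integral => //.
- exact/measurable_EFinP.
- exact/measurable_EFinP.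
- by apply: filterS fg => x -> _.
Qed.

Lemma ae_integrable (f g : T -> R) : measurable_fun [set: T] g ->
  P.-integrable [set: T] (EFin \o f) -> (\forall x \ae P, f x = g x) ->
  P.-integrable [set: T] (EFin \o g).
Proof.
move=> mg fi fg; apply/integrableP; split; first exact/measurable_EFinP.
have mf := measurable_int P fi.
have /integrableP[_] := fi; apply: le_lt_trans.
apply: ae_ge0_le_integral => //.
- by apply: measurableT_comp => //; exact/measurable_EFinP.
- by apply: measurableT_comp.
- by apply: filterS fg => x /= -> _.
Qed.

Lemma Rintegral_dist_le (f g : T -> R) (c : R) :
  P.-integrable [set: T] (EFin \o f) -> P.-integrable [set: T] (EFin \o g) ->
  (\forall x \ae P, `|f x - g x| <= c) ->
  `|\int[P]_x f x - \int[P]_x g x| <= c.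
Proof.
move=> fi gi fgc; rewrite -RintegralB//.
have fgi : P.-integrable [set: T] (EFin \o (fun x => f x - g x)).
  by apply: eq_integrable (integrableB _ fi gi).
have /measurable_EFinP mfg := measurable_int P fgi.
apply: le_trans (le_normr_Rintegral _ fgi) _ => //.
rewrite -lee_fin fineK; last first.
  exact: (integrable_fin_num _ (integrable_norm fgi)).
rewrite -[leRHS]mule1 -P1 -integral_cst//.
have c0 : 0 <= c.
  apply: contrapT => /negP; rewrite -ltNge => c0.
  have : P [set: T] = 0%E.
    apply/(negligibleP _ measurableT).
    case: fgc => N [mN PN sN]; exists N; split => // x _.
    by apply: sN => /= /le_lt_trans /(_ c0); rewrite ltNge normr_ge0.
  by rewrite P1 => /eqP; rewrite eqe oner_eq0.
apply: ae_ge0_le_integral => //.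
- by apply/measurable_EFinP; exact: measurableT_comp.
- by apply: filterS fgc => x ? _; rewrite lee_fin.
Qed.

Lemma Rintegral_unit_interval (phi : T -> R) : measurable_fun [set: T] phi ->
  (forall x, 0 <= phi x <= 1) -> 0 <= \int[P]_x phi x <= 1.
Proof.
move=> mphi phi01; apply/andP; split.
  by apply: Rintegral_ge0 => x _; have /andP[] := phi01 x.
have phii : P.-integrable [set: T] (EFin \o phi).
  apply: (bounded_integrable (C := 1) mphi) => x.
  by have /andP[? ?] := phi01 x; rewrite ger0_norm.
rewrite -[leRHS]Rintegral_prob_cst; apply: le_Rintegral => //.
  exact: cst_integrable.
by move=> x _; have /andP[] := phi01 x.
Qed.

(** The first moment method: were [f] at least [c] wherever [Q] holds, its mean
    would be at least [c].  It turns L^1 convergence into the existence of a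
    single good point. *)
Lemma ae_exists_lt (Q : T -> Prop) (f : T -> R) (c : R) :
  P.-integrable [set: T] (EFin \o f) -> (forall x, 0 <= f x) ->
  (\forall x \ae P, Q x) -> \int[P]_x f x < c -> exists x, Q x /\ f x < c.
Proof.
move=> fi f0 aeQ; apply: contraPP => /forallNP nQ; apply/negP; rewrite -leNgt.
have c0 : (\forall x \ae P, c <= f x).
  by apply: filterS aeQ => x Qx; rewrite leNgt; apply/negP => fc; exact: (nQ x).
have mf := measurable_int P fi.
have [cn|cp] := ltP c 0; first by rewrite (le_trans (ltW cn))// Rintegral_ge0.
rewrite -lee_fin fineK; last exact: integrable_fin_num.
rewrite -[leLHS]mule1 -P1 -integral_cst//.
apply: ae_ge0_le_integral => //.
- by move=> x _; rewrite lee_fin.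
- by apply: filterS c0 => x ? _; rewrite lee_fin.
Qed.

End probability_integrals.

(** * Truncation *)

Section truncation.
Context {R : realType}.

Definition clamp (N : R) (x : R) : R := Num.max (- N) (Num.min N x).

Lemma clamp_le (N x : R) : 0 <= N -> `|clamp N x| <= N.
Proof.
move=> N0; rewrite /clamp ler_norml le_max lexx/= ge_max.
by rewrite ge_min lexx/=; lra.
Qed.

Lemma clamp_id (N x : R) : `|x| <= N -> clamp N x = x.
Proof.
rewrite ler_norml => /andP[Nx xN]; rewrite /clamp.
by rewrite (min_idPr _)// (max_idPr _).
Qed.

Lemma clamp_dist_le (N x : R) : 0 <= N -> `|x - clamp N x| <= `|x|.
Proof.
move=> N0; have [xN|Nx] := leP `|x| N.
  by rewrite clamp_id// subrr normr0.
rewrite /clamp; have [x0|x0] := leP 0 x.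
  rewrite (ger0_norm x0) in Nx *.
  rewrite (min_idPl _) ?(ltW Nx)// (max_idPr _); last by lra.
  by rewrite ger0_norm; lra.
rewrite (ltr0_norm x0) in Nx *.
rewrite (min_idPr _); last by lra.
by rewrite (max_idPl _) ?ler0_norm; lra.
Qed.

Lemma measurable_clamp (N : R) : measurable_fun [set: R] (clamp N).
Proof.
apply: measurable_maxr; first exact: measurable_cst.
by apply: measurable_minr; [exact: measurable_cst|exact: measurable_id].
Qed.

(** Dominated convergence, the dominating function being [h] itself: at each
    point the truncation is eventually exact. *)
Lemma clamp_approx {d : measure_display} {T : measurableType d}
    (P : {measure set T -> \bar R}) (h : T -> R) (e : R) : 0 < e ->
  P.-integrable [set: T] (EFin \o h) -> exists N : nat,
  (\int[P]_x `|h x - clamp N.+1%:R (h x)|%:E <= e%:E)%E.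
Proof.
move=> e0 hi.
have mh : measurable_fun [set: T] h by apply/measurable_EFinP; exact: measurable_int hi.
pose g (n : nat) (x : T) : \bar R := `|h x - clamp n.+1%:R (h x)|%:E.
have mg n : measurable_fun [set: T] (g n).
  apply/measurable_EFinP; apply: measurableT_comp => //.
  apply: measurable_funB => //.
  exact: (measurableT_comp (measurable_clamp _) mh).
have g0 : (\int[P]_x g n x)%E @[n --> \oo] --> (\int[P]_x (cst 0 x))%E.
  apply: (@dominated_cvg _ _ _ P _ measurableT g (cst 0%E) (fun x => `|h x|%:E)) => //.
  - move=> x _.
    have [N hN] : exists N : nat, `|h x| <= N%:R.
      by exists (Num.truncn `|h x|).+1; rewrite ltW// truncnS_gt.
    apply: (cvg_near_cst 0%E); exists N => // n /= Nn.
    rewrite /g clamp_id ?subrr ?normr0// (le_trans hN)// ler_nat.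
    exact: leqW.
  - by have := integrable_norm hi; apply: eq_integrable.
  - by move=> n x _; rewrite /g abse_EFin normr_id lee_fin clamp_dist_le.
rewrite integral_cst// mul0e in g0.
have : \forall n \near \oo, (\int[P]_x g n x <= e%:E)%E.
  have /fine_cvgP[fg /cvgrPdist_le /(_ _ e0)] := g0.
  apply: filterS2 fg => n fn /=; rewrite sub0r normrN ger0_norm.
    by move=> h1; rewrite -(fineK fn) lee_fin.
  by rewrite fine_ge0// integral_ge0// => x _; rewrite /g lee_fin.
by move=> [N _ /(_ N (leqnn N)) hN]; exists N.
Qed.

End truncation.

(** * Covariance of functions of bounded spread *)

Section covariance.
Context {d : measure_display} {T : measurableType d} {R : realType}.
Variable P : {measure set T -> \bar R}.
Hypothesis P1 : P [set: T] = 1%E.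

(** Centring at the midpoint of the range, rather than at the mean, is what
    gives the constant [1 / 4] in the covariance bound. *)
Lemma spread_midpoint (X : T -> R) (a : R) :
  (forall s t, `|X s - X t| <= a) -> exists c, forall s, `|X s - c| <= a / 2.
Proof.
move=> Xa; have [[t _]|T0] := pselect ([set: T] !=set0); last first.
  by exists 0 => s; exfalso; apply: T0; exists s.
have Xub s : ubound (range X) (X s + a).
  by move=> _ [u _ <-]; have := Xa u s; rewrite ler_norml => /andP[]; lra.
have Xsup : has_sup (range X) by split; [exists (X t), t|exists (X t + a)].
exists (sup (range X) - a / 2) => s.
have h1 : X s <= sup (range X) by apply: ub_le_sup; [case: Xsup|exists s].
have h2 : sup (range X) <= X s + a by apply: ge_sup => //; exists (X t), t.
by rewrite ler_norml; apply/andP; split; lra.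
Qed.

Lemma Rintegral_lin2 (f g : T -> R) (a b : R) :
  P.-integrable [set: T] (EFin \o f) -> P.-integrable [set: T] (EFin \o g) ->
  P.-integrable [set: T] (EFin \o (fun s => a * f s + b * g s)) /\
  \int[P]_s (a * f s + b * g s) = a * \int[P]_s f s + b * \int[P]_s g s.
Proof.
move=> fi gi.
have afi : P.-integrable [set: T] (EFin \o (fun s => a * f s)).
  by have := integrableZl measurableT a fi; apply: eq_integrable.
have bgi : P.-integrable [set: T] (EFin \o (fun s => b * g s)).
  by have := integrableZl measurableT b gi; apply: eq_integrable.
split; last by rewrite RintegralD// !RintegralZl.
by have := integrableD measurableT afi bgi; apply: eq_integrable.
Qed.

Lemma sqr_Rintegral_le (Z : T -> R) (C : R) : measurable_fun [set: T] Z ->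
  (forall s, `|Z s| <= C) -> (\int[P]_s Z s) ^+ 2 <= \int[P]_s (Z s ^+ 2).
Proof.
move=> mZ ZC; set m := \int[P]_s Z s.
have Zi : P.-integrable [set: T] (EFin \o Z) := bounded_integrable P1 mZ ZC.
have Z2i : P.-integrable [set: T] (EFin \o (fun s => Z s ^+ 2)).
  apply: (@bounded_integrable _ _ _ _ P1 _ (C ^+ 2)).
    exact: measurable_funX.
  by move=> s; rewrite normrX lerXn2r// nnegrE (le_trans _ (ZC s)).
have [Li] := Rintegral_lin2 (2 * m) (- m ^+ 2) Zi (cst_integrable P1 1).
rewrite (Rintegral_prob_cst P1) -/m (_ : _ + _ = m ^+ 2); last by ring.
move=> <-; apply: le_Rintegral => //.
move=> s _; rewrite -subr_ge0.
by rewrite (_ : _ - _ = (Z s - m) ^+ 2) ?sqr_ge0//=; ring.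
Qed.

(** Polarization replaces Cauchy-Schwarz: with [W = b U + a V] and
    [Z = b U - a V], four times [a b] times the covariance is [Var W - Var Z];
    the second variance is nonnegative and the first at most
    [E (W ^+ 2) <= (a b) ^+ 2]. *)
Lemma bounded_covariance_le (U V : T -> R) (a b : R) : 0 < a -> 0 < b ->
  measurable_fun [set: T] U -> measurable_fun [set: T] V ->
  (forall s, `|U s| <= a / 2) -> (forall s, `|V s| <= b / 2) ->
  \int[P]_s (U s * V s) - \int[P]_s U s * \int[P]_s V s <= a * b / 4.
Proof.
move=> a0 b0 mU mV Ua Vb.
have Ui : P.-integrable [set: T] (EFin \o U) := bounded_integrable P1 mU Ua.
have Vi : P.-integrable [set: T] (EFin \o V) := bounded_integrable P1 mV Vb.
have mUV : measurable_fun [set: T] (fun s => U s * V s).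
  exact: measurable_funM.
have UVi : P.-integrable [set: T] (EFin \o (fun s => U s * V s)).
  apply: (@bounded_integrable _ _ _ _ P1 _ (a / 2 * (b / 2))) => // s.
  by rewrite normrM ler_pM.
pose Z s := b * U s + (- a) * V s.
pose W s := b * U s + a * V s.
have [Zi EZ] := Rintegral_lin2 b (- a) Ui Vi.
have mZ : measurable_fun [set: T] Z.
  by apply/measurable_EFinP; exact: measurable_int Zi.
have [Wi EW] := Rintegral_lin2 b a Ui Vi.
have mW : measurable_fun [set: T] W.
  by apply/measurable_EFinP; exact: measurable_int Wi.
have bd (c : R) s : `|c| = a -> `|b * U s + c * V s| <= a * b.
  move=> ca; apply: le_trans (ler_normD _ _) _; rewrite !normrM ca (gtr0_norm b0).
  have := ler_wpM2l (ltW b0) (Ua s); have := ler_wpM2l (ltW a0) (Vb s); lra.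
have Zab s : `|Z s| <= a * b by apply: bd; rewrite normrN gtr0_norm.
have Wab s : `|W s| <= a * b by apply: bd; rewrite gtr0_norm.
have sqb (Y : T -> R) : measurable_fun [set: T] Y -> (forall s, `|Y s| <= a * b) ->
    P.-integrable [set: T] (EFin \o (fun s => Y s ^+ 2)).
  move=> mY Yab; apply: (@bounded_integrable _ _ _ _ P1 _ ((a * b) ^+ 2)).
    exact: measurable_funX.
  by move=> s; rewrite normrX lerXn2r// nnegrE ?mulr_ge0// ltW.
have W2le : \int[P]_s (W s ^+ 2) <= (a * b) ^+ 2.
  rewrite -[leRHS](Rintegral_prob_cst P1); apply: le_Rintegral => //.
  - exact: sqb.
  - exact: cst_integrable.
  - by move=> s _; rewrite -ler_sqrt ?sqr_ge0// !sqrtr_sqr (le_trans (Wab s))// ler_norm.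
have Z2ge := sqr_Rintegral_le mZ Zab.
have [_ E1] := Rintegral_lin2 1 (- 1) (sqb _ mW Wab) (sqb _ mZ Zab).
have E2 : \int[P]_s (1 * W s ^+ 2 + (- 1) * Z s ^+ 2) =
    4 * a * b * \int[P]_s (U s * V s).
  rewrite -RintegralZl//; apply: eq_Rintegral => s _; rewrite /W /Z; ring.
rewrite EZ in Z2ge.
have ab0 : 0 < a * b by rewrite mulr_gt0.
rewrite -(ler_pM2l ab0) -(ler_pM2l (_ : 0 < 4))//.
have W2ge := sqr_ge0 (\int[P]_s W s); rewrite EW in W2ge.
move: E1 E2 W2le Z2ge W2ge.
set c := \int[P]_s (U s * V s); set u := \int[P]_s U s; set v := \int[P]_s V s.
move=> -> E2 W2le Z2ge W2ge; nra.
Qed.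

Lemma spread_covariance_le (X Y : T -> R) (a b : R) : 0 < a -> 0 < b ->
  measurable_fun [set: T] X -> measurable_fun [set: T] Y ->
  (forall s t, `|X s - X t| <= a) -> (forall s t, `|Y s - Y t| <= b) ->
  P.-integrable [set: T] (EFin \o (fun s => X s * Y s)) /\
  `|\int[P]_s (X s * Y s) - \int[P]_s X s * \int[P]_s Y s| <= a * b / 4.
Proof.
move=> a0 b0 mX mY Xa Yb.
have [x Xx] := spread_midpoint Xa; have [y Yy] := spread_midpoint Yb.
pose U s := X s - x; pose V s := Y s - y.
have mU : measurable_fun [set: T] U by exact: measurable_funB.
have mV : measurable_fun [set: T] V by exact: measurable_funB.
have Ui : P.-integrable [set: T] (EFin \o U) := bounded_integrable P1 mU Xx.
have Vi : P.-integrable [set: T] (EFin \o V) := bounded_integrable P1 mV Yy.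
have UVi : P.-integrable [set: T] (EFin \o (fun s => U s * V s)).
  apply: (@bounded_integrable _ _ _ _ P1 _ (a / 2 * (b / 2))) => [|s].
    exact: measurable_funM.
  by rewrite normrM ler_pM//; [exact: Xx|exact: Yy].
have C1 := cst_integrable P1 1.
have [Xi EX] := Rintegral_lin2 1 x Ui C1.
have [Yi EY] := Rintegral_lin2 1 y Vi C1.
have [UVi1 EUV1] := Rintegral_lin2 y x Ui Vi.
have [UVi2 EUV2] := Rintegral_lin2 1 1 UVi UVi1.
have [UVi3 EUV3] := Rintegral_lin2 1 (x * y) UVi2 C1.
rewrite !(Rintegral_prob_cst P1) in EX EY EUV3.
rewrite EUV2 EUV1 in EUV3.
have eX : X = (fun s => 1 * U s + x * cst 1 s).
  by apply/funext => s; rewrite /U /=; ring.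
have eY : Y = (fun s => 1 * V s + y * cst 1 s).
  by apply/funext => s; rewrite /V /=; ring.
have eXY : (fun s => X s * Y s) = (fun s =>
    1 * (1 * (U s * V s) + 1 * (y * U s + x * V s)) + x * y * cst 1 s).
  by apply/funext => s; rewrite /U /V /=; ring.
have -> : \int[P]_s (X s * Y s) - \int[P]_s X s * \int[P]_s Y s =
    \int[P]_s (U s * V s) - \int[P]_s U s * \int[P]_s V s.
  rewrite eXY EUV3 (_ : \int[P]_s X s = \int[P]_s U s + x * 1)
    1?(_ : \int[P]_s Y s = \int[P]_s V s + y * 1); first by ring.
  + by rewrite {1}eY EY; ring.
  + by rewrite {1}eX EX; ring.
split; first by rewrite eXY.
rewrite ler_norml bounded_covariance_le// andbT lerNl opprB.
have mNU : measurable_fun [set: T] (fun s => (-1) * U s).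
  exact: measurable_funM.
have NUa s : `|(-1) * U s| <= a / 2 by rewrite mulN1r normrN; exact: Xx.
have := bounded_covariance_le a0 b0 mNU mV NUa Yy.
rewrite (RintegralZl _ _ Ui)//.
under eq_Rintegral do rewrite -mulrA.
by rewrite RintegralZl//; lra.
Qed.

(** A function whose spread is controlled only almost everywhere is replaced,
    on the exceptional null set, by one of its regular values. *)
Lemma ae_spread_version (X : T -> R) (B : set T) (a : R) :
  measurable_fun [set: T] X -> (\forall s \ae P, B s) ->
  (forall s t, B s -> B t -> `|X s - X t| <= a) ->
  exists2 X' : T -> R, measurable_fun [set: T] X' /\
    (\forall s \ae P, X s = X' s) & forall s t, `|X' s - X' t| <= a.
Proof.
move=> mX [N [mN PN sN]] Xa.
have NB s : ~ N s -> B s by move=> nN; apply: contrapT => nB; exact/nN/sN.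
have [s0 nNs0] : exists s0, ~ N s0.
  apply: contrapT => /forallNP nN.
  have NT : N = setT by apply/seteqP; split => // s _; apply: contrapT; exact: nN.
  by have := P1; rewrite -NT PN => /eqP; rewrite eqe eq_sym oner_eq0.
exists (fun s => if s \in N then X s0 else X s).
  split; last by exists N; split => // s /= h; apply: contrapT => nNs;
    apply: h; rewrite memNset.
  apply: measurable_fun_ifT => //.
  apply: (@measurable_fun_bool _ _ _ _ true); rewrite setTI.
  by rewrite (_ : _ @^-1` _ = N)//; apply/seteqP; split=> s /= sN';
    [exact: set_mem|exact: mem_set].
move=> s t /=.
by case: ifPn => sN'; case: ifPn => tN; apply: Xa; apply: NB => //;
  rewrite -notin_setE.
Qed.

Lemma ae_cst_covariance (X Y : T -> R) (B : set T) :
  measurable_fun [set: T] X -> P.-integrable [set: T] (EFin \o Y) ->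
  (\forall s \ae P, B s) -> (forall s t, B s -> B t -> X s = X t) ->
  P.-integrable [set: T] (EFin \o (fun s => X s * Y s)) /\
  \int[P]_s (X s * Y s) = \int[P]_s X s * \int[P]_s Y s.
Proof.
move=> mX Yi Bae Xc.
have mY : measurable_fun [set: T] Y by apply/measurable_EFinP; exact: measurable_int Yi.
have [s0 [Bs0 _]] : exists s, B s /\ cst 0 s < 1 :> R.
  apply: (ae_exists_lt P1 _ _ Bae) => //; first exact: cst_integrable.
  by rewrite Rintegral_prob_cst.
have XE : \forall s \ae P, cst (X s0) s = X s.
  by apply: filterS Bae => s Bs; apply: Xc.
have XYE : \forall s \ae P, X s0 * Y s = X s * Y s.
  by apply: filterS XE => s <-.
have cYi : P.-integrable [set: T] (EFin \o (fun s => X s0 * Y s)).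
  by have := integrableZl measurableT (X s0) Yi; apply: eq_integrable.
have mXY : measurable_fun [set: T] (fun s => X s * Y s) by exact: measurable_funM.
split; first exact: ae_integrable cYi XYE.
rewrite -(ae_Rintegral _ mX XE)// (Rintegral_prob_cst P1) -RintegralZl//.
by apply/esym/ae_Rintegral => //; apply/measurable_EFinP; exact: measurable_int cYi.
Qed.

(** The extended-real form of the covariance bound, for oscillations [a] and
    [b] that may be infinite.  The convention [0 * +oo = 0] is harmless: when
    [D * a] or [D * b] vanishes, one of the functions is almost surely constant
    and the covariance is zero.  An infinite bound is kept apart because the
    integrability of the product may then fail. *)
Lemma fibre_covariance_le (X Y : T -> R) (B : set T) (D : R) (a b : \bar R) :
  0 <= D -> (0 <= a)%E -> (0 <= b)%E ->
  P.-integrable [set: T] (EFin \o X) -> P.-integrable [set: T] (EFin \o Y) ->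
  (\forall s \ae P, B s) ->
  (forall s t, B s -> B t -> (`|X s - X t|%:E <= D%:E * a)%E) ->
  (forall s t, B s -> B t -> (`|Y s - Y t|%:E <= D%:E * b)%E) ->
  ((D ^+ 2 / 4)%:E * (a * b) = +oo)%E \/
  P.-integrable [set: T] (EFin \o (fun s => X s * Y s)) /\
  (`|\int[P]_s (X s * Y s) - \int[P]_s X s * \int[P]_s Y s|%:E
     <= (D ^+ 2 / 4)%:E * (a * b))%E.
Proof.
move=> D0 a0 b0 Xi Yi Bae Xa Yb.
have mX : measurable_fun [set: T] X by apply/measurable_EFinP; exact: measurable_int Xi.
have mY : measurable_fun [set: T] Y by apply/measurable_EFinP; exact: measurable_int Yi.
have bd0 : (0 <= (D ^+ 2 / 4)%:E * (a * b))%E.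
  by rewrite !mule_ge0// lee_fin divr_ge0// sqr_ge0.
have const (Z : T -> R) c : (D%:E * c = 0)%E ->
    (forall s t, B s -> B t -> (`|Z s - Z t|%:E <= D%:E * c)%E) ->
    forall s t, B s -> B t -> Z s = Z t.
  move=> -> Z0 s t Bs Bt; apply/eqP; rewrite -subr_eq0 -normr_eq0 eq_le normr_ge0.
  by rewrite -lee_fin Z0.
have [Da0|Da0] := eqVneq (D%:E * a)%E 0%E.
  right; have [XYi ->] := ae_cst_covariance mX Yi Bae (const _ _ Da0 Xa).
  by rewrite subrr normr0.
have [Db0|Db0] := eqVneq (D%:E * b)%E 0%E.
  right; have [XYi E] := ae_cst_covariance mY Xi Bae (const _ _ Db0 Yb).
  under [X in EFin \o X]eq_fun do rewrite mulrC.
  split=> //; under eq_Rintegral do rewrite mulrC.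
  by rewrite E mulrC subrr normr0.
have Dp : 0 < D.
  by rewrite lt_neqAle D0 andbT; apply: contra Da0 => /eqP <-; rewrite mul0e.
have D2p : 0 < D ^+ 2 / 4 by rewrite divr_gt0// exprn_gt0.
have ap : (0 < a)%E.
  by rewrite lt_neqAle a0 andbT; apply: contra Da0 => /eqP <-; rewrite mule0.
have bp : (0 < b)%E.
  by rewrite lt_neqAle b0 andbT; apply: contra Db0 => /eqP <-; rewrite mule0.
case: a => [a| |//] in a0 ap Xa bd0 Da0 *; last first.
  by left; rewrite gt0_mulye// gt0_muley// lte_fin.
case: b => [b| |//] in b0 bp Yb bd0 Db0 *; last first.
  by left; rewrite gt0_muley// gt0_muley// lte_fin.
right.
have {}Xa s t : B s -> B t -> `|X s - X t| <= D * a.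
  by move=> Bs Bt; rewrite -lee_fin EFinM Xa.
have {}Yb s t : B s -> B t -> `|Y s - Y t| <= D * b.
  by move=> Bs Bt; rewrite -lee_fin EFinM Yb.
have [X' [mX' XX'] X'a] := ae_spread_version mX Bae Xa.
have [Y' [mY' YY'] Y'b] := ae_spread_version mY Bae Yb.
have Dap : 0 < D * a by rewrite mulr_gt0.
have Dbp : 0 < D * b by rewrite mulr_gt0.
have XYE : \forall s \ae P, X' s * Y' s = X s * Y s.
  by apply: filterS2 XX' YY' => s -> ->.
have [XYi cov] := spread_covariance_le Dap Dbp mX' mY' X'a Y'b.
have mXY : measurable_fun [set: T] (fun s => X s * Y s) by exact: measurable_funM.
have mXY' : measurable_fun [set: T] (fun s => X' s * Y' s) by exact: measurable_funM.
split; first exact: ae_integrable XYi XYE.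
rewrite -(ae_Rintegral mXY' mXY XYE) (ae_Rintegral mX mX' XX').
rewrite (ae_Rintegral mY mY' YY') -!EFinM lee_fin (le_trans cov)//.
by rewrite le_eqVlt; apply/orP; left; apply/eqP; field.
Qed.

End covariance.

(** * Disintegration along a kernel *)

Lemma measurable_fun_Rintegral_kernel {d1 d2 : measure_display}
    {T1 : measurableType d1} {T2 : measurableType d2} {R : realType}
    (k : T1 -> {measure set T2 -> \bar R}) (h : T2 -> R) :
  (forall U, measurable U -> measurable_fun [set: T1] (k ^~ U)) ->
  measurable_fun [set: T2] h ->
  measurable_fun [set: T1] (fun s => \int[k s]_x h x).
Proof.
move=> mk mh; apply: measurableT_comp => //.
under eq_fun do rewrite integralE.
have mhE : measurable_fun [set: T2] (EFin \o h) by exact/measurable_EFinP.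
apply: emeasurable_funB; apply: measurable_fun_integral_kernel => //.
- exact: measurable_funepos.
- exact: measurable_funeneg.
Qed.

(** The reference measure is the trace on [T2] of a measure on [T0], along a
    measurable map [phi].  In the applications [phi] is the identity between
    two sigma-algebras on the same carrier, and integrals with respect to the
    trace need not be distinguished from integrals with respect to [m]. *)
Section disintegration.
Context {d0 d1 d2 : measure_display} {T0 : measurableType d0}
  {T1 : measurableType d1} {T2 : measurableType d2} {R : realType}.
Variables (phi : T0 -> T2) (m : {measure set T0 -> \bar R}).
Variables (nu : {measure set T1 -> \bar R}) (k : T1 -> {measure set T2 -> \bar R}).
Hypothesis mphi : measurable_fun [set: T0] phi.
Hypothesis mk : forall U, measurable U -> measurable_fun [set: T1] (k ^~ U).
Hypothesis km : forall U, measurable U ->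
  (\int[nu]_s k s U = m (phi @^-1` U))%E.

Import HBNNSimple.

Let disintegration_nnsfun (g : {nnsfun T2 >-> R}) :
  (\int[nu]_s \int[k s]_x (g x)%:E = \int[m]_x (g (phi x))%:E)%E.
Proof.
have -> : (\int[m]_x (g (phi x))%:E = \int[pushforward m phi]_y (g y)%:E)%E.
  rewrite ge0_integral_pushforward//; first exact/measurable_EFinP.
  by move=> y _; rewrite lee_fin.
rewrite integralT_nnsfun sintegralE.
under eq_integral do rewrite integralT_nnsfun sintegralE.
rewrite ge0_integral_fsum//=.
- apply: eq_fsbigr => r /set_mem[x _ <-]; rewrite ge0_integralZl//.
  + by rewrite km.
  + exact: mk.
  + by rewrite lee_fin.
- by move=> r; apply: measurable_funeM; exact: mk.
- by move=> r s _; exact: nnsfun_mulemu_ge0.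
Qed.

Lemma ge0_disintegration (h : T2 -> \bar R) :
  measurable_fun [set: T2] h -> (forall x, 0 <= h x)%E ->
  (\int[nu]_s \int[k s]_x h x = \int[m]_x h (phi x))%E.
Proof.
move=> mh h0; pose g := nnsfun_approx measurableT mh.
have gh x : (g n x)%:E @[n --> \oo] --> h x by exact: cvg_nnsfun_approx.
have mg n : measurable_fun [set: T2] (EFin \o g n) by exact/measurable_EFinP.
have g0 n x : (0 <= (g n x)%:E)%E by rewrite lee_fin.
have ndg x : {homo (fun n => (g n x)%:E) : a b / (a <= b)%N >-> (a <= b)%E}.
  by move=> a b ab; rewrite lee_fin; exact/lefP/nd_nnsfun_approx.
have lhs : (\int[nu]_s \int[k s]_x (g n x)%:E)%E @[n --> \oo] -->
    (\int[nu]_s \int[k s]_x h x)%E.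
  have -> : (\int[nu]_s \int[k s]_x h x =
      \int[nu]_s limn (fun n => \int[k s]_x (g n x)%:E))%E.
    apply: eq_integral => s _; rewrite -monotone_convergence//.
    by apply: eq_integral => x _; apply/esym/cvg_lim.
  apply: cvg_monotone_convergence => //.
  - by move=> n; apply: measurable_fun_integral_kernel => //; exact: mg.
  - by move=> n s _; exact: integral_ge0.
  - by move=> s _ a b ab; apply: ge0_le_integral => //;
      [exact: mg|exact: mg|move=> x _; exact: ndg].
have rhs : (\int[m]_x (g n (phi x))%:E)%E @[n --> \oo] --> (\int[m]_x h (phi x))%E.
  have -> : (\int[m]_x h (phi x) = \int[m]_x limn (fun n => (g n (phi x))%:E))%E.
    by apply: eq_integral => x _; apply/esym/cvg_lim.
  apply: cvg_monotone_convergence => //.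
  by move=> n; exact: (measurableT_comp (mg n) mphi).
move: rhs; under eq_fun do rewrite -disintegration_nnsfun.
by move=> rhs; apply: cvg_unique lhs rhs.
Qed.

(** For a signed [h], the inner integrals make sense only almost everywhere:
    integrability of [h] makes the mean of [\int[k s]_x `|h x|] finite, hence
    almost every inner integral as well. *)
Lemma disintegration (h : T2 -> R) : measurable_fun [set: T2] h ->
  m.-integrable [set: T0] (EFin \o (h \o phi)) ->
  [/\ \forall s \ae nu, (k s).-integrable [set: T2] (EFin \o h),
      nu.-integrable [set: T1] (EFin \o (fun s => \int[k s]_x h x)),
      \int[nu]_s \int[k s]_x h x = \int[m]_x h (phi x) &
      (\int[nu]_s `|\int[k s]_x h x|%:E <= \int[m]_x `|h (phi x)|%:E)%E].
Proof.
move=> mh /integrableP[mhphi hoo].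
have mhE : measurable_fun [set: T2] (EFin \o h) by exact/measurable_EFinP.
have mabs : measurable_fun [set: T2] (fun x => `|h x|%:E).
  by apply/measurable_EFinP; exact: measurableT_comp.
have mkint (g : T2 -> \bar R) : measurable_fun [set: T2] g ->
    (forall x, 0 <= g x)%E -> measurable_fun [set: T1] (fun s => \int[k s]_x g x)%E.
  by move=> mg g0; exact: measurable_fun_integral_kernel.
have mint : measurable_fun [set: T1] (fun s => \int[k s]_x h x).
  exact: measurable_fun_Rintegral_kernel.
have kabs : (\int[nu]_s \int[k s]_x `|h x|%:E = \int[m]_x `|h (phi x)|%:E)%E.
  by rewrite ge0_disintegration// => x; rewrite lee_fin.
have kabsi : nu.-integrable [set: T1] (fun s => \int[k s]_x `|h x|%:E)%E.
  apply/integrableP; split; first by apply: mkint => // x; rewrite lee_fin.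
  under eq_integral do rewrite gee0_abs ?integral_ge0//.
  by rewrite kabs.
have kint : \forall s \ae nu, (k s).-integrable [set: T2] (EFin \o h).
  have := integrable_ae measurableT kabsi; apply: filterS => s /(_ I) fin.
  by apply/integrableP; split => //; rewrite ltey_eq fin.
have lenorm s : (k s).-integrable [set: T2] (EFin \o h) ->
    (`|\int[k s]_x h x|%:E <= \int[k s]_x `|h x|%:E)%E.
  move=> ki; rewrite EFin_normr_Rintegral//; apply: le_abse_integral => //.
have leint : (\int[nu]_s `|\int[k s]_x h x|%:E <= \int[m]_x `|h (phi x)|%:E)%E.
  rewrite -kabs; apply: ae_ge0_le_integral => //.
  - by apply/measurable_EFinP; exact: measurableT_comp.
  - by move=> s _; exact: integral_ge0.
  - exact: (measurable_int _ kabsi).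
  - by apply: filterS kint => s /lenorm + _.
split => //.
  apply/integrableP; split; first exact/measurable_EFinP.
  exact: le_lt_trans leint hoo.
have part (g : T2 -> \bar R) : measurable_fun [set: T2] g ->
    (forall x, 0 <= g x)%E -> (forall x, g x <= `|h x|%:E)%E ->
    nu.-integrable [set: T1] (fun s => \int[k s]_x g x)%E.
  move=> mg g0 gh; apply: le_integrable kabsi => //; first exact: mkint.
  move=> s _; rewrite !gee0_abs ?integral_ge0//.
  by apply: ge0_le_integral.
have posi : nu.-integrable [set: T1] (fun s => \int[k s]_x ((EFin \o h)^\+ x))%E.
  apply: part => //; first exact: measurable_funepos.
  by move=> x; rewrite funeposE ge_max !lee_fin ler_norm normr_ge0.
have negi : nu.-integrable [set: T1] (fun s => \int[k s]_x ((EFin \o h)^\- x))%E.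
  apply: part => //; first exact: measurable_funeneg.
  by move=> x; rewrite funenegE ge_max !lee_fin -normrN ler_norm normr_ge0.
congr fine.
rewrite [RHS]integralE.
transitivity (\int[nu]_s ((\int[k s]_x ((EFin \o h)^\+ x))
   - (\int[k s]_x ((EFin \o h)^\- x))))%E.
  apply: ae_eq_integral => //.
  - exact/measurable_EFinP.
  - apply: emeasurable_funB.
      exact: (measurable_int _ posi).
    exact: (measurable_int _ negi).
  - apply: filterS kint => s ki _.
    by rewrite fineK ?integrable_fin_num// integralE.
rewrite integralB//; congr (_ - _)%E.
  rewrite ge0_disintegration//; last exact: measurable_funepos.
  by apply: eq_integral => x _; rewrite !funeposE.
rewrite ge0_disintegration//; last exact: measurable_funeneg.
by apply: eq_integral => x _; rewrite !funenegE.
Qed.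

End disintegration.

(** * Ultralimits of uniformly bounded densities *)

(** Compactness of a segment; the point is that the image of an ultrafilter is
    again an ultrafilter. *)
Lemma ultra_bounded_cvg {R : realType} {I : Type} (U : set_system I)
    {UF : UltraFilter U} (a : I -> R) (C : R) :
  (forall i, `|a i| <= C) -> cvg (a i @[i --> U]).
Proof.
move=> aC.
have pF : ProperFilter (a @ U) by exact: fmap_proper_filter.
have aU : UltraFilter (a @ U).
  split=> // G GP aG; apply/seteqP; split=> [A GA|A aA]; last exact: aG.
  have [//|nA] := in_ultra_setVsetC (a @^-1` A) UF.
  have : G (~` A) by apply: aG.
  by move=> /(filterI GA); rewrite setICr => /filter_not_empty.
have := @segment_compact R (- C) C; rewrite compact_ultra => /(_ _ aU).
case; last by move=> p [_ ap]; apply/cvg_ex; exists p.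
by apply: (@filterE _ U) => i /=; rewrite in_itv/= -ler_norml; exact: aC.
Qed.

Section ultralimit.
Context {d : measure_display} {T : measurableType d} {R : realType}.
Variables (mu : probability T R) (J : Type) (U : set_system J).
Context {UF : UltraFilter U}.
Variables (w : J -> T -> R) (K : R).
Hypothesis mw : forall i, measurable_fun [set: T] (w i).
Hypothesis w0 : forall i x, 0 <= w i x.
Hypothesis wK : forall i x, w i x <= K.
Hypothesis w1 : forall i, \int[mu]_x w i x = 1.

Let mu1 : mu [set: T] = 1%E. Proof. exact: probability_setT. Qed.

Let bounded_mfun (phi : T -> R) := measurable_fun [set: T] phi /\
  exists C, forall x, `|phi x| <= C.

Let lam (phi : T -> R) : R := lim (\int[mu]_x (phi x * w i x) @[i --> U]).

Let phiw_bd phi C i x : `|phi x| <= C -> `|phi x * w i x| <= C * K.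
Proof. by move=> h; rewrite normrM (ger0_norm (w0 _ _)) ler_pM. Qed.

Let phiw_int phi i : bounded_mfun phi ->
  mu.-integrable [set: T] (EFin \o (fun x => phi x * w i x)).
Proof.
move=> [mphi [C phiC]]; apply: (@bounded_integrable _ _ _ _ mu1 _ (C * K)).
  exact: measurable_funM.
by move=> x; apply: phiw_bd.
Qed.

Let lam_cvg phi : bounded_mfun phi ->
  \int[mu]_x (phi x * w i x) @[i --> U] --> lam phi.
Proof.
move=> bphi; have [mphi [C phiC]] := bphi.
apply: (@ultra_bounded_cvg _ _ _ _ _ (C * K)) => i.
have := Rintegral_dist_le mu1 (phiw_int i bphi) (cst_integrable mu1 0).
move=> /(_ (C * K)); rewrite Rintegral_prob_cst// subr0; apply.
by apply: aeW => x; rewrite subr0; apply: phiw_bd.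
Qed.

Let lam_lin2 phi psi (a b : R) : bounded_mfun phi -> bounded_mfun psi ->
  bounded_mfun (fun x => a * phi x + b * psi x) /\
  lam (fun x => a * phi x + b * psi x) = a * lam phi + b * lam psi.
Proof.
move=> bphi bpsi; have [mphi [C phiC]] := bphi; have [mpsi [C' psiC]] := bpsi.
have b2 : bounded_mfun (fun x => a * phi x + b * psi x).
  split; first by apply: measurable_funD; exact: measurable_funM.
  exists (`|a| * C + `|b| * C') => x; apply: le_trans (ler_normD _ _) _.
  by rewrite !normrM lerD// ler_wpM2l.
split => //; apply: cvg_unique (lam_cvg b2) _ => //.
rewrite (_ : (fun i => _) = (fun i => a * \int[mu]_x (phi x * w i x) +
    b * \int[mu]_x (psi x * w i x))); last first.
  apply/funext => i.
  have [_ <-] := Rintegral_lin2 a b (phiw_int i bphi) (phiw_int i bpsi).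
  by apply: eq_Rintegral => x _; ring.
by apply: cvgD; apply: cvgMr; exact: lam_cvg.
Qed.

Let lam_bounds phi : bounded_mfun phi -> (forall x, 0 <= phi x) ->
  0 <= lam phi <= K * \int[mu]_x phi x.
Proof.
move=> bphi phi0; have [mphi [C phiC]] := bphi.
have cv := lam_cvg bphi; apply/andP; split.
  apply: (cvgr_to_ge cv); apply: filterE => i.
  by apply: Rintegral_ge0 => x _; rewrite mulr_ge0.
apply: (cvgr_to_le cv); apply: filterE => i.
have phii := bounded_integrable mu1 mphi phiC.
rewrite -RintegralZl//; apply: le_Rintegral => //.
- exact: phiw_int.
- by have := integrableZl measurableT K phii; apply: eq_integrable.
- by move=> x _; rewrite mulrC ler_wpM2r.
Qed.

Let bounded_indic A : measurable A -> bounded_mfun \1_A.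
Proof.
move=> mA; split; first exact: measurable_indic.
by exists 1 => x; rewrite indicE; case: (_ \in _); rewrite /= ?normr1 ?normr0.
Qed.

Let indic_ge0 A (x : T) : 0 <= \1_A x :> R.
Proof. by rewrite indicE. Qed.

(* The absolute value matters only on nonmeasurable sets, where a measure is
   still required to be nonnegative. *)
Let nuf (A : set T) : \bar R := `|lam \1_A|%:E.

Let nufE A : measurable A -> nuf A = (lam \1_A)%:E.
Proof.
move=> mA; rewrite /nuf ger0_norm//.
by have /andP[] := lam_bounds (bounded_indic mA) (fun x => indic_ge0 A x).
Qed.

Let lam0 : lam (cst 0) = 0.
Proof.
rewrite /lam (_ : (fun i => _) = cst 0) ?lim_cst//; apply/funext => i.
by under eq_Rintegral do rewrite mul0r; rewrite Rintegral_prob_cst.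
Qed.

Let lam1 : lam (cst 1) = 1.
Proof.
rewrite /lam (_ : (fun i => _) = cst 1) ?lim_cst//; apply/funext => i.
by under eq_Rintegral do rewrite mul1r; rewrite w1.
Qed.

Let lamU A B : measurable A -> measurable B -> A `&` B = set0 ->
  lam \1_(A `|` B) = lam \1_A + lam \1_B.
Proof.
move=> mA mB AB0.
have [_] := lam_lin2 1 1 (bounded_indic mA) (bounded_indic mB).
rewrite !mul1r => <-; congr lam; apply/funext => x; rewrite !mul1r !indicE in_setU.
have [xA|xA] := boolP (x \in A); have [xB|xB] := boolP (x \in B) => /=; rewrite ?addr0 ?add0r//.
by have := in_set0 x; rewrite -AB0 in_setI xA xB.
Qed.

(* Finite additivity passes to the limit; countable additivity follows from
   the domination of the limit by [K * mu]. *)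
Let nuf_sigma_additive : semi_sigma_additive nuf.
Proof.
move=> F mF tF mUF; rewrite nufE//.
pose A n := \big[setU/set0]_(i < n) F i.
have mA n : measurable (A n) by exact: bigsetU_measurable.
have sumE n : (\sum_(0 <= i < n) nuf (F i))%E = (lam \1_(A n))%:E.
  rewrite big_mkord /A; elim: n => [|n ih].
    by rewrite !big_ord0 indic0 lam0.
  rewrite big_ord_recr/= ih (nufE (mF n)) -EFinD -(lamU (mA n) (mF n)).
    by rewrite big_ord_recr.
  apply/seteqP; split => // x [] /=; rewrite /A -bigcup_mkord => -[i /= ltin Fix] Fnx.
  by move: ltin; rewrite (tF i n) ?ltnn//; exists x.
under eq_fun do rewrite sumE.
apply/fine_cvgP; split; first exact: nearW.
rewrite /comp/=.
pose dl n := \bigcup_i F i `\` A n.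
have mdl n : measurable (dl n) by exact: measurableD.
have Asub n : A n `<=` \bigcup_i F i.
  by rewrite /A -bigcup_mkord; exact: bigcup_subset.
have lamD n : lam \1_(\bigcup_i F i) = lam \1_(A n) + lam \1_(dl n).
  rewrite -(lamU (mA n) (mdl n)); first by rewrite /dl setDUK.
  by rewrite /dl setIDA setIC -setIDA setDv setI0.
have dl0 : mu (dl n) @[n --> \oo] --> 0%E.
  have cap0 : \bigcap_n dl n = set0.
    apply/seteqP; split => // x dlx; have [[i _ Fix] _] := dlx 0%N I.
    have [_] := dlx i.+1 I; apply; rewrite /A -bigcup_mkord.
    by exists i => //=.
  rewrite -(measure0 mu) -cap0; apply: nonincreasing_cvg_mu => //.
  - by rewrite (le_lt_trans (probability_le1 _ _))// ltry.
  - exact: bigcap_measurable.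
  - move=> a b ab; apply/subsetPset; apply: setDS.
    rewrite /A -!bigcup_mkord; apply: bigcup_subset => i /= ia.
    exact: leq_trans ia ab.
have dlr : K * fine (mu (dl n)) @[n --> \oo] --> 0.
  rewrite -[0](mulr0 K); apply: cvgMr.
  exact: (fine_cvg dl0).
apply/cvgrPdist_le => e e0.
have /cvgrPdist_le /(_ _ e0) := dlr; apply: filterS => n.
rewrite sub0r normrN (lamD n) (addrC (lam _)) addrK.
have /andP[h0 h1] := lam_bounds (bounded_indic (mdl n)) (fun x => indic_ge0 _ x).
rewrite /Rintegral integral_indic// setIT in h1.
by rewrite !ger0_norm ?(le_trans h0)//; exact: le_trans.
Qed.

Let nuf0 : nuf set0 = 0%E.
Proof. by rewrite nufE// indic0 lam0. Qed.

Let nuf_ge0 A : (0 <= nuf A)%E.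
Proof. by rewrite lee_fin. Qed.

HB.instance Definition _ := isMeasure.Build _ _ _ nuf
  nuf0 nuf_ge0 nuf_sigma_additive.

Let nufT : nuf [set: T] = 1%E.
Proof. by rewrite nufE// indicT lam1. Qed.

HB.instance Definition _ := Measure_isProbability.Build _ _ _ nuf nufT.

Let nu : probability T R := nuf.

Import HBNNSimple.

Let lam_sum (s : seq R) (F : R -> T -> R) :
  (forall r, bounded_mfun (F r)) ->
  bounded_mfun (fun x => \sum_(r <- s) r * F r x) /\
  lam (fun x => \sum_(r <- s) r * F r x) = \sum_(r <- s) r * lam (F r).
Proof.
move=> bF; elim: s => [|r s [bs ih]].
  rewrite big_nil (_ : (fun x => _) = cst 0).
    by split => //; split => //; exists 0 => x; rewrite normr0.
  by apply/funext => x; rewrite big_nil.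
have [b2 E] := lam_lin2 r 1 (bF r) bs.
rewrite big_cons -ih -[X in _ = _ + X]mul1r -E.
rewrite (_ : (fun x => \sum_(j <- _ :: _) _) =
  (fun x => r * F r x + 1 * \sum_(r <- s) r * F r x))//.
by apply/funext => x; rewrite big_cons mul1r.
Qed.

Let integral_nu_nnsfun (g : {nnsfun T >-> R}) :
  bounded_mfun g /\ (\int[nu]_x (g x)%:E = (lam g)%:E)%E.
Proof.
rewrite integralT_nnsfun sintegralE fsbig_finite//=.
have [bg E] := lam_sum (finmap.enum_fset (fset_set (range g)))
  (fun r => bounded_indic (measurable_sfunP g (measurable_set1 r))).
have gE : (g : T -> R) = (fun x => \sum_(r <- finmap.enum_fset (fset_set (range g)))
    r * \1_(g @^-1` [set r]) x).
  by apply/funext => x; rewrite {1}fimfunE fsbig_finite.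
split; first by rewrite gE.
rewrite {3}gE E -sumEFin; apply: eq_bigr => r _.
by rewrite -[X in (_ * X)%E]/(nuf _) nufE.
Qed.

Let integral_nu_le (phi : T -> R) : measurable_fun [set: T] phi ->
  (forall x, 0 <= phi x <= 1) -> \int[nu]_x phi x <= lam phi.
Proof.
move=> mphi phi01.
have bphi : bounded_mfun phi.
  split => //; exists 1 => x; have /andP[? ?] := phi01 x.
  by rewrite ger0_norm.
have mphiE : measurable_fun [set: T] (EFin \o phi) by exact/measurable_EFinP.
have phi0 x : (0 <= (phi x)%:E)%E by rewrite lee_fin; have /andP[] := phi01 x.
have phii : nu.-integrable [set: T] (EFin \o phi).
  by case: bphi => _ [C phiC]; apply: bounded_integrable phiC => //; exact: nufT.
pose g := nnsfun_approx measurableT mphiE.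
rewrite -lee_fin fineK; last exact: integrable_fin_num.
have cvg_g : (\int[nu]_x (g n x)%:E)%E @[n --> \oo] --> (\int[nu]_x (phi x)%:E)%E.
  have -> : (\int[nu]_x (phi x)%:E = \int[nu]_x limn (fun n => (g n x)%:E))%E.
    apply: eq_integral => x _; apply/esym/cvg_lim => //.
    by apply: cvg_nnsfun_approx => // y _; exact: phi0.
  apply: cvg_monotone_convergence => //.
  - by move=> n; exact/measurable_EFinP.
  - by move=> n x _; rewrite lee_fin.
  - by move=> x _ a b ab; rewrite lee_fin; exact/lefP/nd_nnsfun_approx.
apply: (cvge_to_le cvg_g); apply: nearW => n.
have [bg ->] := integral_nu_nnsfun (g n); rewrite lee_fin.
have cg := lam_cvg bg; have cphi := lam_cvg bphi.
rewrite -subr_ge0; apply: (cvgr_to_ge (cvgB cphi cg)); apply: filterE => i.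
rewrite subr_ge0.
apply: le_Rintegral => //; [exact: phiw_int|exact: phiw_int|].
move=> x _; apply: ler_wpM2r => //; rewrite -lee_fin.
have gphi : (g m x)%:E @[m --> \oo] --> (phi x)%:E.
  by apply: cvg_nnsfun_approx => // y _; exact: phi0.
apply: (cvge_to_ge gphi); exists n => // m /= nm.
by rewrite lee_fin; exact/lefP/nd_nnsfun_approx.
Qed.

(** Setwise limits of probabilities need not be countably additive; here they
    are because all the densities are below [K].  Only an upper bound of the
    limit functional is obtained by approximating [phi] from below with simple
    functions; applied to [1 - phi] as well, it gives equality. *)
Lemma ultralimit_probability : exists nu : probability T R,
  forall phi : T -> R, measurable_fun [set: T] phi ->
  (forall x, 0 <= phi x <= 1) ->
  \int[mu]_x (phi x * w i x) @[i --> U] --> \int[nu]_x phi x.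
Proof.
exists nu => phi mphi phi01.
have bphi : bounded_mfun phi.
  split => //; exists 1 => x; have /andP[? ?] := phi01 x.
  by rewrite ger0_norm.
suff -> : \int[nu]_x phi x = lam phi by exact: lam_cvg.
apply/eqP; rewrite eq_le integral_nu_le//=.
have b1 : bounded_mfun (cst 1).
  by split => //; exists 1 => x; rewrite normr1.
have phii : nu.-integrable [set: T] (EFin \o phi).
  by case: bphi => _ [C phiC]; apply: bounded_integrable phiC => //; exact: nufT.
have [[mC _] E] := lam_lin2 1 (-1) b1 bphi.
have := integral_nu_le mC; rewrite E lam1.
have [_ ->] := Rintegral_lin2 1 (-1) (cst_integrable nufT 1) phii.
rewrite (Rintegral_prob_cst nufT).
suff h : forall x, 0 <= 1 * cst 1 x + (-1) * phi x <= 1 by move=> /(_ h); lra.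
by move=> x; have := phi01 x; rewrite /=; lra.
Qed.

End ultralimit.

(** * Sites and sigma-algebras *)

Section sites.
Context {R : realType} {E : metricType R} {Omega : set {ptws int -> E}}.
Variable w0 : Omega.
Implicit Types (L M : set int) (s t : conf w0).

Lemma cfg_measurable_sub L M (A : set (conf w0)) : L `<=` M ->
  measurable (A : set (cfg w0 L)) -> measurable (A : set (cfg w0 M)).
Proof.
move=> LM; apply: sub_sigma_algebra2 => _ [i [B [Li mB ->]]].
by exists i, B; split => //; exact: LM.
Qed.

Lemma cfg_measurable_fun_sub L M d (T : measurableType d) (g : conf w0 -> T) :
  L `<=` M -> measurable_fun [set: cfg w0 L] (g : cfg w0 L -> T) ->
  measurable_fun [set: cfg w0 M] (g : cfg w0 M -> T).
Proof.
move=> LM mg _ Y mY; apply: (cfg_measurable_sub LM).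
exact: mg.
Qed.

Definition agree L s t := forall i, L i -> Defs.coord i s = Defs.coord i t.

(** The sets with this invariance form a sigma-algebra that contains the
    cylinders over [L]. *)
Lemma measurable_agree L (A : set (conf w0)) s t :
  measurable (A : set (cfg w0 L)) -> agree L s t -> A s -> A t.
Proof.
move=> mA; pose G := [set B : set (conf w0) |
  forall s t, agree L s t -> B s -> B t].
suff : (@cyl R E Omega w0 L).-sigma.-measurable `<=` G by move=> /(_ _ mA); apply.
apply: smallest_sub.
  split => [//|B GB x y xy [_ nBx]|F GF x y xy [n _ Fnx]].
  - split => // By; apply: nBx; apply: GB By => i Li; exact/esym/xy.
  - by exists n => //; apply: GF Fnx.
move=> _ [i [B [Li _ ->]]] x y xy /=; by rewrite xy.
Qed.

Lemma measurable_fun_agree L (g : conf w0 -> R) s t :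
  measurable_fun [set: cfg w0 L] (g : cfg w0 L -> R) ->
  agree L s t -> g s = g t.
Proof.
move=> mg st.
have mA : measurable (g @^-1` [set g s] : set (cfg w0 L)).
  by rewrite -[X in measurable X]setTI; apply: mg.
by have /= -> := measurable_agree mA st erefl.
Qed.

Lemma coord_measurable L i (e : E) : L i ->
  measurable (Defs.coord i @^-1` [set e] : set (cfg w0 L)).
Proof.
move=> Li; apply: sub_sigma_algebra; exists i, [set e]; split => //.
have [_ sC _] := smallest_sigma_algebra [set: E] open.
rewrite -[X in <<s _ >> X]setCK -setTD; apply: sC.
apply: sub_sigma_algebra; rewrite /= openC.
apply: accessible_closed_set1; apply: hausdorff_accessible.
exact: metric_hausdorff.
Qed.

End sites.
(** * Kernels of a left interval-specification *)

Section kernels.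
Context {R : realType} {E : metricType R} {Omega : set {ptws int -> E}}.
Variable w0 : Omega.
Variable f : lis w0.
Implicit Types (l m : int) (s t w : conf w0).

Lemma past_sub (i j : int) : i <= j -> [set` `]-oo, i]] `<=` [set` `]-oo, j]].
Proof. by move=> ij k /=; rewrite !in_itv/= => /le_trans; apply. Qed.

Lemma past_lt_sub l m : l <= m -> [set` `]-oo, (l - 1)]] `<=` [set` `]-oo, m]].
Proof. by move=> lm; apply: past_sub; lia. Qed.

Lemma lis_prob l m w : f l m w [set: cfg w0 `]-oo, m]] = 1%E.
Proof. exact: prob_kernel. Qed.

#[global] Instance lis_ae_filter l m w : Filter (almost_everywhere (f l m w)).
Proof. exact: ae_filter_ringOfSetsType. Qed.

Lemma lis_proper_ae l m w (B : set (conf w0)) : l <= m ->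
  measurable (B : set (cfg w0 `]-oo, (l - 1)])) -> B w ->
  \forall s \ae f l m w, B s.
Proof.
move=> lm mB Bw; exists (~` B : set (conf w0)); split => //.
  apply: (cfg_measurable_sub (past_lt_sub lm)).
  exact: (measurableC mB).
rewrite lis_proper//; last exact: (measurableC mB).
by rewrite indicE memNset.
Qed.

(** Properness for functions: under the kernel started from [w], a function of
    the past is frozen at its value at [w]. *)
Lemma lis_proper_eq l m w d (T : measurableType d) (g : conf w0 -> T) : l <= m ->
  measurable_fun [set: cfg w0 `]-oo, (l - 1)]] (g : cfg w0 `]-oo, (l - 1)] -> T) ->
  measurable [set g w] -> \forall s \ae f l m w, g s = g w.
Proof.
move=> lm mg mgw.
apply: (@lis_proper_ae l m w (g @^-1` [set g w])) => //.
by rewrite -[X in measurable X]setTI; exact: mg.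
Qed.

(** The agreement with [w] on the past is a countable intersection of events on
    which one coordinate is frozen. *)
Lemma lis_proper_agree l m w : l <= m ->
  \forall s \ae f l m w, agree [set` `]-oo, (l - 1)]] s w.
Proof.
move=> lm.
have : \forall s \ae f l m w, forall n (i : int), unpickle n = Some i ->
    i <= l - 1 -> Defs.coord i s = Defs.coord i w.
  apply/ae_foralln => n.
  case ni : (unpickle n) => [i|]; last by apply: aeW.
  have [il|il] := leP i (l - 1); last first.
    by apply: aeW => s j [<-]; rewrite leNgt il.
  have mi : measurable (Defs.coord i @^-1` [set Defs.coord i w]
      : set (cfg w0 `]-oo, (l - 1)])).
    by apply: coord_measurable; rewrite /= in_itv.
  by apply: filterS (lis_proper_ae lm mi erefl) => s /= si j [<-] _.
apply: filterS => s si i; rewrite /= in_itv/= => il.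
exact: (si (pickle i) i (pickleK i)).
Qed.

Lemma lis_kernel_measurable l m L (U : set (conf w0)) :
  [set` `]-oo, (l - 1)]] `<=` L -> measurable (U : set (cfg w0 `]-oo, m])) ->
  measurable_fun [set: cfg w0 L] (fun s : cfg w0 L => f l m s U).
Proof.
move=> lL mU.
have mk := measurable_kernel (f l m) U mU.
exact: (cfg_measurable_fun_sub lL mk).
Qed.

Lemma lis_integral_measurable l m L (h : conf w0 -> R) :
  [set` `]-oo, (l - 1)]] `<=` L ->
  measurable_fun [set: cfg w0 `]-oo, m]] (h : cfg w0 `]-oo, m] -> R) ->
  measurable_fun [set: cfg w0 L] ((fun s => \int[f l m s]_x h x) : cfg w0 L -> R).
Proof.
move=> lL mh; apply: (cfg_measurable_fun_sub lL).
apply: measurable_fun_Rintegral_kernel => //.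
by move=> U mU; exact: measurable_kernel.
Qed.

Lemma lis_consistent_set l m l' (w : conf w0) (U : set (conf w0)) : l <= m -> l' <= l ->
  measurable (U : set (cfg w0 `]-oo, m])) ->
  (\int[f l' m w]_s f l m s U = f l' m w U)%E.
Proof.
move=> lm l'l mU.
have := @lis_consistent _ _ _ _ f l m l' m lm l'l (lexx m) (fun x => (\1_U x)%:E).
move=> /(_ _ _ w); rewrite integral_indic// setIT => <-.
- by apply: eq_integral => s _; rewrite integral_indic// setIT.
- by apply/measurable_EFinP; exact: measurable_indic.
- by move=> x; rewrite lee_fin indicE.
Qed.

(** By consistency, averaging over [[l, m']] may be preceded by averaging over
    [[l, m]]; the result of the latter depends on the past of [l] only, and is
    frozen. *)
Lemma ge0_lis_interval_ext l m m' (w : conf w0) (h : conf w0 -> \bar R) :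
  l <= m -> m <= m' ->
  measurable_fun [set: cfg w0 `]-oo, m]] (h : cfg w0 `]-oo, m] -> \bar R) ->
  (forall x, 0 <= h x)%E ->
  (\int[f l m' w]_x h x = \int[f l m w]_x h x)%E.
Proof.
move=> lm mm' mh h0.
rewrite -(@lis_consistent _ _ _ _ f l m l m')//.
have mg : measurable_fun [set: cfg w0 `]-oo, (l - 1)]]
    ((fun s => (\int[f l m s]_x h x)%E) : cfg w0 `]-oo, (l - 1)] -> \bar R).
  apply: measurable_fun_integral_kernel => //.
  by move=> U mU; exact: measurable_kernel.
transitivity (\int[f l m' w]_s (cst (\int[f l m w]_x h x) s))%E.
  apply: ge0_ae_eq_integral => //.
  - apply: (cfg_measurable_fun_sub _ mg).
    by apply: past_lt_sub; exact: le_trans mm'.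
  - by move=> s _; exact: integral_ge0.
  - by move=> s _; exact: integral_ge0.
  - have lm' : l <= m' by exact: le_trans mm'.
    apply: filterS (lis_proper_eq (w := w) lm' mg _) => [s /= -> //|].
    exact: emeasurable_set1.
by rewrite integral_cst// lis_prob mule1.
Qed.

Lemma lis_interval_ext l m m' (w : conf w0) (h : conf w0 -> R) :
  l <= m -> m <= m' ->
  measurable_fun [set: cfg w0 `]-oo, m]] (h : cfg w0 `]-oo, m] -> R) ->
  \int[f l m' w]_x h x = \int[f l m w]_x h x.
Proof.
move=> lm mm' mh.
have mhE : measurable_fun [set: cfg w0 `]-oo, m]] (EFin \o h : cfg w0 `]-oo, m] -> \bar R).
  exact/measurable_EFinP.
congr fine; rewrite integralE [RHS]integralE.
congr (_ - _)%E; apply: ge0_lis_interval_ext => //.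
- exact: measurable_funepos.
- exact: measurable_funeneg.
Qed.

End kernels.
(** * Covariance at finite volume *)

Section finite_volume.
Context {R : realType} {E : metricType R} {Omega : set {ptws int -> E}}.
Variable w0 : Omega.
Hypothesis dist_bounded : has_ubound (dists E).

Lemma mdist_le_diam (x y : E) : mdist x y <= diam E.
Proof. by apply: ub_le_sup => //; exists (x, y). Qed.

Lemma diam_ge0 : 0 <= diam E.
Proof.
have e := Defs.coord 0 (w0 : conf w0).
by rewrite (le_trans _ (mdist_le_diam e e))// mdist_ge0.
Qed.

Lemma osc_ge0 V j (h : conf w0 -> R) : (0 <= osc V j h)%E.
Proof.
apply: ereal_sup_ubound; exists (w0 : conf w0), (w0 : conf w0); split => //.
by rewrite subrr normr0 mul0r.
Qed.

(** If the values at [j] differ, the quotient in the oscillation is a genuine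
    one; if they coincide, so do the values of [g]. *)
Lemma osc_agree j (g : conf w0 -> R) (s t : conf w0) :
  measurable_fun [set: cfg w0 `]-oo, j]] (g : cfg w0 `]-oo, j] -> R) ->
  agree [set` `]-oo, (j - 1)]] s t ->
  (`|g s - g t|%:E <= (diam E)%:E * osc [set` `]-oo, j]] j g)%E.
Proof.
move=> mg st.
have st' k : [set` `]-oo, j]] k -> k != j -> Defs.coord k s = Defs.coord k t.
  by move=> /=; rewrite in_itv/= => kj kNj; apply: st; rewrite /= in_itv/=; lia.
have [sjtj|sjtj] := eqVneq (Defs.coord j s) (Defs.coord j t).
  rewrite (measurable_fun_agree (s := s) (t := t) mg).
    by rewrite subrr normr0 mule_ge0 ?osc_ge0// lee_fin diam_ge0.
  move=> k kj; have [->//|] := eqVneq k j; exact: st'.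
have d0 : 0 < mdist (Defs.coord j s) (Defs.coord j t) by rewrite mdist_gt0.
rewrite -[X in X%:E](@divfK _ (mdist (Defs.coord j s) (Defs.coord j t))) ?gt_eqF//.
rewrite mulrC EFinM; apply: lee_pmul.
- by rewrite lee_fin mdist_ge0.
- by rewrite lee_fin divr_ge0// mdist_ge0.
- by rewrite lee_fin mdist_le_diam.
- by apply: ereal_sup_ubound; exists s, t.
Qed.

Variable f : lis w0.

Lemma lis_disintegration j l m w (h : conf w0 -> R) : j <= l -> l <= m ->
  measurable_fun [set: cfg w0 `]-oo, m]] (h : cfg w0 `]-oo, m] -> R) ->
  (f j m w).-integrable [set: cfg w0 `]-oo, m]] (EFin \o h) ->
  [/\ \forall s \ae f j m w,
        (f l m s).-integrable [set: cfg w0 `]-oo, m]] (EFin \o h),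
      (f j m w).-integrable [set: cfg w0 `]-oo, m]]
        (EFin \o (fun s => \int[f l m s]_x h x)) &
      \int[f j m w]_s \int[f l m s]_x h x = \int[f j m w]_x h x].
Proof.
move=> jl lm mh hi.
have mk U : measurable (U : set (cfg w0 `]-oo, m])) ->
    measurable_fun [set: cfg w0 `]-oo, m]] (fun s : cfg w0 `]-oo, m] => f l m s U).
  by move=> mU; apply: lis_kernel_measurable => //; exact: past_lt_sub.
have km U : measurable (U : set (cfg w0 `]-oo, m])) ->
    (\int[f j m w]_s f l m s U = f j m w (id @^-1` U))%E.
  by move=> mU; exact: lis_consistent_set.
by have [? ? ? _] := disintegration (@measurable_id _ _ setT) mk km mh hi.
Qed.

Variables (c m : int) (h1 h2 : conf w0 -> R).
Hypothesis cm : c < m.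
Hypothesis mh1 : measurable_fun [set: cfg w0 `]-oo, m]] (h1 : cfg w0 `]-oo, m] -> R).
Hypothesis mh2 : measurable_fun [set: cfg w0 `]-oo, c]] (h2 : cfg w0 `]-oo, c] -> R).

Let mh2m : measurable_fun [set: cfg w0 `]-oo, m]] (h2 : cfg w0 `]-oo, m] -> R).
Proof. by apply: cfg_measurable_fun_sub mh2; apply: past_sub; exact: ltW. Qed.

Let mh12 : measurable_fun [set: cfg w0 `]-oo, m]]
  ((fun s => h1 s * h2 s) : cfg w0 `]-oo, m] -> R).
Proof. exact: (measurable_funM mh1 mh2m). Qed.

Let int3 l w := [/\ (f l m w).-integrable [set: cfg w0 `]-oo, m]] (EFin \o h1),
  (f l m w).-integrable [set: cfg w0 `]-oo, m]] (EFin \o h2) &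
  (f l m w).-integrable [set: cfg w0 `]-oo, m]] (EFin \o (fun s => h1 s * h2 s))].

(** Both kernels can be taken with the same right end [m].  At [j = c] the left
    side is [h2] by convention, and the right side is [h2] by properness. *)
Lemma lis_app_interval_ext j : j <= c ->
  lis_app f (j + 1) c h2 = (fun w => \int[f (j + 1) m w]_s h2 s).
Proof.
move=> jc; apply/funext => w; rewrite /lis_app; case: ifPn => [jc1|jc1].
  by rewrite (lis_interval_ext f w jc1 (ltW cm) mh2).
have jE : j = c by lia.
rewrite jE; have cm1 : c + 1 <= m by lia.
have ae : \forall s \ae f (c + 1) m w, h2 s = cst (h2 w) s.
  apply: lis_proper_eq => //; rewrite addrK; exact: mh2.
by rewrite (ae_Rintegral mh2m _ ae)// Rintegral_prob_cst// lis_prob.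
Qed.

Let bound j : \bar R := ((diam E ^+ 2 / 4)%:E *
  (osc [set` `]-oo, j]] j (lis_app f (j + 1) m h1) *
   osc [set` `]-oo, j]] j (lis_app f (j + 1) c h2)))%E.

Let bound_ge0 j : (0 <= bound j)%E.
Proof.
by rewrite !mule_ge0 ?osc_ge0// lee_fin divr_ge0 ?sqr_ge0.
Qed.

(** Induction on the number of resampled sites before [c + 1], with the law of
    total covariance as the inductive step. *)
Lemma finite_volume_covariance (n : nat) (w : conf w0) :
  @int3 (c + 1 - n%:Z) w ->
  (`|\int[f (c + 1 - n%:Z) m w]_s (h1 s * h2 s) -
     \int[f (c + 1 - n%:Z) m w]_s h1 s * \int[f (c + 1 - n%:Z) m w]_s h2 s|%:E
   <= \sum_(i < n) bound (c - i%:Z)%R)%E.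
Proof.
elim: n w => [|n IH] w.
  rewrite subr0 big_ord0 => -[i1 i2 _]; rewrite lee_fin.
  have cm1 : c + 1 <= m by lia.
  have ae : \forall s \ae f (c + 1) m w, agree [set` `]-oo, c]] s w.
    apply: filterS (lis_proper_agree f w cm1) => s sw k kc.
    by apply: sw; rewrite addrK.
  under eq_Rintegral do rewrite mulrC.
  have h2cst s t : agree [set` `]-oo, c]] s w -> agree [set` `]-oo, c]] t w ->
      h2 s = h2 t.
    move=> sw tw; apply: (measurable_fun_agree mh2) => k kc.
    by rewrite (sw k kc) (tw k kc).
  have [_ ->] := ae_cst_covariance (lis_prob f _ _ w) mh2m i1 ae h2cst.
  by rewrite mulrC subrr normr0.
have -> : c + 1 - n.+1%:Z = c - n%:Z by lia.
rewrite big_ord_recr/=; set j := c - n%:Z => -[i1 i2 i12].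
have jE : c + 1 - n%:Z = j + 1 by rewrite /j; lia.
rewrite jE in IH.
have jj1 : j <= j + 1 by lia.
have j1m : j + 1 <= m by rewrite /j; lia.
have jm : j <= m by lia.
have jc : j <= c by rewrite /j; lia.
set S := (\sum_(i < n) _)%E in IH *.
have S0 : (0 <= S)%E by apply: sume_ge0 => i _; exact: bound_ge0.
have [a1 I1 E1] := lis_disintegration jj1 j1m mh1 i1.
have [a2 I2 E2] := lis_disintegration jj1 j1m mh2m i2.
have [a12 I12 E12] := lis_disintegration jj1 j1m mh12 i12.
pose M (h : conf w0 -> R) (s : conf w0) : R := \int[f (j + 1)%R m s]_x h x.
have mM (h : conf w0 -> R) :
    measurable_fun [set: cfg w0 `]-oo, m]] (h : cfg w0 `]-oo, m] -> R) ->
    measurable_fun [set: cfg w0 `]-oo, j]]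
      (M h : cfg w0 `]-oo, j] -> R).
  by move=> mh; apply: lis_integral_measurable => //; rewrite addrK.
have osc_fibre (h : conf w0 -> R) :
    measurable_fun [set: cfg w0 `]-oo, m]] (h : cfg w0 `]-oo, m] -> R) ->
    forall s t, agree [set` `]-oo, (j - 1)]] s w -> agree [set` `]-oo, (j - 1)]] t w ->
    (`|M h s - M h t|%:E <= (diam E)%:E * osc [set` `]-oo, j]] j (M h))%E.
  move=> mh s t sw tw; apply: osc_agree; first exact: mM.
  by move=> k kj; rewrite (sw k kj) (tw k kj).
have cov := fibre_covariance_le (lis_prob f j m w) diam_ge0
  (osc_ge0 _ _ _) (osc_ge0 _ _ _) I1 I2 (lis_proper_agree f w jm)
  (osc_fibre h1 mh1) (osc_fibre h2 mh2m).
have bE : bound j = ((diam E ^+ 2 / 4)%:E *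
    (osc [set` `]-oo, j]] j (M h1) * osc [set` `]-oo, j]] j (M h2)))%E.
  rewrite /bound lis_app_interval_ext//; congr (_ * (osc _ _ _ * _))%E.
  by apply/funext => s; rewrite /lis_app j1m.
rewrite -bE in cov.
(* From here on, infinite bounds being trivial, all the quantities are finite. *)
case: S S0 IH => [S S0 IH| S0 IH|//]; last first.
  by rewrite addye ?leey// gt_eqF// (lt_le_trans _ (bound_ge0 j))// ltNyr.
case: cov => [->|[I cov]]; first by rewrite addey ?leey.
have S_ae : \forall s \ae f j m w, `|\int[f (j + 1)%R m s]_x (h1 x * h2 x) -
    \int[f (j + 1)%R m s]_x h1 x * \int[f (j + 1)%R m s]_x h2 x| <= S.
  by apply: filterS3 a1 a2 a12 => s ? ? ?; rewrite -lee_fin; apply: IH; split.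
have := Rintegral_dist_le (lis_prob f j m w) I12 I S_ae.
rewrite E12; rewrite E1 E2 in cov => SS.
rewrite -lee_fin in SS; apply: le_trans (leeD SS cov).
by rewrite -EFinD lee_fin ler_distD.
Qed.

End finite_volume.
(** * Triviality of the left tail *)

Section left_tail.
Context {R : realType} {E : metricType R} {Omega : set {ptws int -> E}}.
Variable w0 : Omega.
Variables (f : lis w0) (mu : probability (cfg w0 setT) R).
Hypothesis mu_lis : lis_measure f mu.

Let mu1 : mu [set: cfg w0 setT] = 1%E. Proof. exact: probability_setT. Qed.

Let cfg_id_measurable L : measurable_fun [set: cfg w0 setT]
  ((fun x => x) : cfg w0 setT -> cfg w0 L).
Proof.
by move=> _ Y mY; rewrite setTI; apply: (cfg_measurable_sub _ mY).
Qed.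

Let mfT L (g : conf w0 -> R) :
  measurable_fun [set: cfg w0 L] (g : cfg w0 L -> R) ->
  measurable_fun [set: cfg w0 setT] (g : cfg w0 setT -> R).
Proof. exact: cfg_measurable_fun_sub. Qed.

Lemma lis_measure_disintegration l m (h : conf w0 -> R) : l <= m ->
  measurable_fun [set: cfg w0 `]-oo, m]] (h : cfg w0 `]-oo, m] -> R) ->
  mu.-integrable [set: cfg w0 setT] (EFin \o h) ->
  [/\ \forall s \ae mu, (f l m s).-integrable [set: cfg w0 `]-oo, m]] (EFin \o h),
      mu.-integrable [set: cfg w0 setT] (EFin \o (fun s => \int[f l m s]_x h x)),
      \int[mu]_s \int[f l m s]_x h x = \int[mu]_x h x &
      (\int[mu]_s `|\int[f l m s]_x h x|%:E <= \int[mu]_x `|h x|%:E)%E].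
Proof.
move=> lm mh hi.
have mk U : measurable (U : set (cfg w0 `]-oo, m])) ->
    measurable_fun [set: cfg w0 setT] (fun s : cfg w0 setT => f l m s U).
  by move=> mU; apply: lis_kernel_measurable.
have km U : measurable (U : set (cfg w0 `]-oo, m])) ->
    (\int[mu]_s f l m s U =
     mu (((fun x => x) : cfg w0 setT -> cfg w0 `]-oo, m]) @^-1` U))%E.
  by move=> mU; exact: mu_lis.
by have [? ? ? ?] := @disintegration _ _ _ (cfg w0 setT) (cfg w0 setT)
  (cfg w0 `]-oo, m]) R _ mu mu (f l m) (@cfg_id_measurable _) mk km h mh hi.
Qed.

(** The analogue, for consistent measures, of taking out what is known from a
    conditional expectation. *)
Lemma lis_measure_pull_out l m (h g : conf w0 -> R) (C C' : R) : l <= m ->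
  measurable_fun [set: cfg w0 `]-oo, m]] (h : cfg w0 `]-oo, m] -> R) ->
  measurable_fun [set: cfg w0 `]-oo, (l - 1)]] (g : cfg w0 `]-oo, (l - 1)] -> R) ->
  (forall x, `|h x| <= C) -> (forall x, `|g x| <= C') ->
  \int[mu]_x (h x * g x) = \int[mu]_s ((\int[f l m s]_x h x) * g s).
Proof.
move=> lm mh mg hC gC.
have mgm : measurable_fun [set: cfg w0 `]-oo, m]] (g : cfg w0 `]-oo, m] -> R).
  exact: cfg_measurable_fun_sub (past_lt_sub lm) mg.
have mhg : measurable_fun [set: cfg w0 `]-oo, m]]
    ((fun x => h x * g x) : cfg w0 `]-oo, m] -> R) by exact: (measurable_funM mh mgm).
have hgi : mu.-integrable [set: cfg w0 setT] (EFin \o (fun x => h x * g x)).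
  apply: (bounded_integrable (C := C * C') mu1); first exact: mfT mhg.
  by move=> x; rewrite normrM ler_pM.
have [_ _ <- _] := lis_measure_disintegration lm mhg hgi.
apply: eq_Rintegral => s _.
have hi : (f l m s).-integrable [set: cfg w0 `]-oo, m]] (EFin \o h).
  exact: (bounded_integrable (lis_prob f l m s) mh hC).
rewrite -RintegralZr//; apply: ae_Rintegral => //.
  exact: (measurable_funM mh (measurable_cst (g s))).
by apply: filterS (lis_proper_eq f lm mg (measurable_set1 (g s))) => x ->.
Qed.

Hypothesis mu_only : forall nu : probability (cfg w0 setT) R, lis_measure f nu ->
  forall A : set (cfg w0 setT), measurable A -> nu A = mu A.
Variables (U : set_system nat).
Context {UU : UltraFilter U}.
Hypothesis Uoo : \oo `<=` U.
Variables (c m : int).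
Hypothesis cm : c <= m.

Let l (n : nat) : int := c - n%:Z.

Let lm n : l n <= m. Proof. by rewrite /l; lia. Qed.

(** The functions [w n] below are densities.  Any limit of the probabilities
    [w n * mu] is consistent with [f], because [w n] is eventually measurable
    with respect to the past of any given interval, and so can be pulled out;
    by uniqueness it is [mu]. *)
Lemma lis_avg_sqr_cvg (phi : conf w0 -> R) :
  measurable_fun [set: cfg w0 `]-oo, m]] (phi : cfg w0 `]-oo, m] -> R) ->
  (forall x, 0 <= phi x <= 1) ->
  \int[mu]_s ((\int[f (l n) m s]_x phi x) ^+ 2) @[n --> U] -->
  (\int[mu]_x phi x) ^+ 2.
Proof.
move=> mphi phi01; set p := \int[mu]_x phi x.
pose g n s := \int[f (l n) m s]_x phi x.
have phi1 x : `|phi x| <= 1 by have /andP[? ?] := phi01 x; rewrite ger0_norm.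
have g01 n s : 0 <= g n s <= 1 
  by exact: (Rintegral_unit_interval (lis_prob f (l n) m s) mphi).
have g1 n s : `|g n s| <= 1 by have /andP[? ?] := g01 n s; rewrite ger0_norm.
have mg n : measurable_fun [set: cfg w0 `]-oo, (l n - 1)]]
    (g n : cfg w0 `]-oo, (l n - 1)] -> R) by exact: lis_integral_measurable.
have phii : mu.-integrable [set: cfg w0 setT] (EFin \o phi).
  exact: (bounded_integrable mu1 (mfT mphi) phi1).
have gi n : mu.-integrable [set: cfg w0 setT] (EFin \o g n).
  exact: (bounded_integrable mu1 (mfT (mg n)) (g1 n)).
have Eg n : \int[mu]_s g n s = p.
  by have [] := lis_measure_disintegration (lm n) mphi phii.
have p01 : 0 <= p <= 1.
  exact: (Rintegral_unit_interval mu1 (mfT mphi)).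
pose w n s := 1 + g n s - p.
have mw n : measurable_fun [set: cfg w0 `]-oo, (l n - 1)]]
    (w n : cfg w0 `]-oo, (l n - 1)] -> R).
  by apply: measurable_funB => //; exact: measurable_funD.
have w02 n s : 0 <= w n s <= 2 by have := g01 n s; rewrite /w; lra.
have w2 n s : `|w n s| <= 2 by have /andP[? ?] := w02 n s; rewrite ger0_norm.
have w1 n : \int[mu]_s w n s = 1.
  have [_ E1] := Rintegral_lin2 (1 - p) 1 (cst_integrable mu1 1) (gi n).
  have -> : w n = (fun s => (1 - p) * cst 1 s + 1 * g n s).
    by apply/funext => s; rewrite /w /=; ring.
  by rewrite E1 (Rintegral_prob_cst mu1) Eg; ring.
have [nu nuE] := @ultralimit_probability _ _ _ mu _ U UU w 2 (fun n => mfT (mw n))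
  (fun n s => proj1 (andP (w02 n s))) (fun n s => proj2 (andP (w02 n s))) w1.
have nu_lis : lis_measure f nu.
  move=> j k jk A mA.
  have mAT : measurable (A : set (cfg w0 setT)) by exact: cfg_measurable_sub mA.
  pose psi s := fine (f j k s A).
  have le1 s : (f j k s A <= 1)%E.
    by rewrite -(lis_prob f j k s) le_measure// inE.
  have psiE s : f j k s A = (psi s)%:E.
    by rewrite fineK// ge0_fin_numE// (le_lt_trans (le1 s))// ltry.
  have mpsi : measurable_fun [set: cfg w0 setT] (psi : cfg w0 setT -> R).
    by apply: measurableT_comp => //; exact: lis_kernel_measurable.
  have psi01 s : 0 <= psi s <= 1.
    by rewrite -!lee_fin -psiE measure_ge0 le1.
  have m1A : measurable_fun [set: cfg w0 setT] (\1_A : cfg w0 setT -> R).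
    exact: measurable_indic.
  have A01 s : 0 <= (\1_A s : R) <= 1.
    by rewrite indicE; case: (_ \in _); rewrite /= lexx ler01.
  have nu1 : nu [set: cfg w0 setT] = 1%E by exact: probability_setT.
  have nupsi : nu.-integrable [set: cfg w0 setT] (EFin \o psi).
    apply: (bounded_integrable (C := 1) nu1 mpsi) => s.
    by have /andP[? ?] := psi01 s; rewrite ger0_norm.
  suff E1 : \int[nu]_s psi s = \int[nu]_s \1_A s.
    have -> : nu A = (\int[nu]_s \1_A s)%:E.
      rewrite /Rintegral integral_indic// setIT fineK// ge0_fin_numE//.
      by rewrite (le_lt_trans (probability_le1 _ _))// ltry.
    rewrite -E1 fineK; last exact: integrable_fin_num.
    by apply: eq_integral => s _; rewrite psiE.
  have c1 := nuE _ mpsi psi01; have c2 := nuE _ m1A A01.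
  apply: (cvg_unique _ c1) => //.
  apply: cvg_trans c2; apply: near_eq_cvg.
  have : U [set n | (`|c - j| <= n)%N] by apply: Uoo; exact: nbhs_infty_ge.
  apply: filterS => n /= cjn.
  have lnj : l n <= j by rewrite /l; lia.
  have mwj : measurable_fun [set: cfg w0 `]-oo, (j - 1)]]
      (w n : cfg w0 `]-oo, (j - 1)] -> R).
    by apply: cfg_measurable_fun_sub (mw n); apply: past_sub; lia.
  have mAk : measurable_fun [set: cfg w0 `]-oo, k]] (\1_A : cfg w0 `]-oo, k] -> R).
    exact: measurable_indic.
  have A1 s : `|\1_A s : R| <= 1.
    by have /andP[? ?] := A01 s; rewrite ger0_norm.
  rewrite (lis_measure_pull_out jk mAk mwj A1 (w2 n)).
  apply: eq_Rintegral => s _; congr (_ * _).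
  by rewrite /Rintegral integral_indic// setIT.
have nuphi : \int[nu]_x phi x = p.
  congr fine; apply: eq_measure_integral => A mA _; exact: mu_only.
have cw := nuE _ (mfT mphi) phi01; rewrite nuphi in cw.
have -> : p ^+ 2 = p - (1 - p) * p by ring.
have -> : (fun n => \int[mu]_s (g n s ^+ 2)) =
    (fun n => \int[mu]_x (phi x * w n x) - (1 - p) * p).
  apply/funext => n.
  have mphig : measurable_fun [set: cfg w0 setT]
      ((fun x => phi x * g n x) : cfg w0 setT -> R).
    exact: (measurable_funM (mfT mphi) (mfT (mg n))).
  have phigi : mu.-integrable [set: cfg w0 setT] (EFin \o (fun x => phi x * g n x)).
    apply: (bounded_integrable (C := 1) mu1 mphig) => x.
    by rewrite normrM mulr_ile1.
  have [_ E1] := Rintegral_lin2 (1 - p) 1 phii phigi.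
  have -> : (fun x => phi x * w n x) = (fun x => (1 - p) * phi x + 1 * (phi x * g n x)).
    by apply/funext => x; rewrite /w; ring.
  rewrite E1 (lis_measure_pull_out (lm n) mphi (mg n) phi1 (g1 n)) -/p.
  transitivity (\int[mu]_s (g n s * g n s)).
    by apply: eq_Rintegral => s _; rewrite expr2.
  by rewrite /g; ring.
by apply: cvgB => //; exact: cvg_cst.
Qed.

(** Convergence in L^2 implies convergence in L^1, through the inequality
    [x <= e / 2 + x ^+ 2 / (2 * e)]. *)
Lemma lis_avg_dist_cvg (phi : conf w0 -> R) (e : R) : 0 < e ->
  measurable_fun [set: cfg w0 `]-oo, m]] (phi : cfg w0 `]-oo, m] -> R) ->
  (forall x, 0 <= phi x <= 1) ->
  \forall n \near U, (\int[mu]_s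
    `|\int[f (l n) m s]_x phi x - \int[mu]_x phi x|%:E <= e%:E)%E.
Proof.
move=> e0 mphi phi01; set p := \int[mu]_x phi x.
have e20 : 0 < e ^+ 2 by rewrite exprn_gt0.
have /cvgrPdist_le /(_ _ e20) := lis_avg_sqr_cvg mphi phi01.
apply: filterS => n; set g := fun s => \int[f (l n) m s]_x phi x.
rewrite -/p => sqe.
have g01 s : 0 <= g s <= 1.
  exact: (Rintegral_unit_interval (lis_prob f (l n) m s) mphi).
have g1 s : `|g s| <= 1 by have /andP[? ?] := g01 s; rewrite ger0_norm.
have mg : measurable_fun [set: cfg w0 setT] (g : cfg w0 setT -> R).
  by apply: lis_integral_measurable mphi.
have mg2 : measurable_fun [set: cfg w0 setT] ((fun s => g s ^+ 2) : cfg w0 setT -> R).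
  exact: measurable_funX.
have gi : mu.-integrable [set: cfg w0 setT] (EFin \o g).
  exact: (bounded_integrable mu1 mg g1).
have g2i : mu.-integrable [set: cfg w0 setT] (EFin \o (fun s => g s ^+ 2)).
  apply: (bounded_integrable (C := 1) mu1 mg2) => s.
  by rewrite normrX expr_le1.
have phii : mu.-integrable [set: cfg w0 setT] (EFin \o phi).
  apply: (bounded_integrable (C := 1) mu1 (mfT mphi)) => x.
  by have /andP[? ?] := phi01 x; rewrite ger0_norm.
have [_ _ Eg _] := lis_measure_disintegration (lm n) mphi phii.
rewrite -/g -/p in Eg.
pose a := (2 * e)^-1.
have [i1 E1] := Rintegral_lin2 a (- (2 * a * p)) g2i gi.
have [i2 E2] := Rintegral_lin2 1 (e / 2 + a * p ^+ 2) i1 (cst_integrable mu1 1).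
rewrite E1 (Rintegral_prob_cst mu1) Eg in E2.
set q := (X in mu.-integrable _ (EFin \o X)) in i2 E2.
have mq : measurable_fun [set: cfg w0 setT] (q : cfg w0 setT -> R).
  by apply/measurable_EFinP; exact: measurable_int i2.
have aE : a * (2 * e) = 1 by rewrite /a mulVf// mulf_neq0// gt_eqF.
have a0 : 0 < a by rewrite invr_gt0 mulr_gt0.
have gpq s : `|g s - p| <= q s.
  have -> : q s = a * (`|g s - p| - e) ^+ 2 + `|g s - p| * (a * (2 * e)) .
    have -> : (`|g s - p| - e) ^+ 2 = (g s - p) ^+ 2 - 2 * e * `|g s - p| + e ^+ 2.
      by rewrite -(real_normK (num_real (g s - p))); ring.
    rewrite /q /= (_ : e / 2 = a * e ^+ 2); first by ring.
    by rewrite /a; field; rewrite gt_eqF.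
  by rewrite aE mulr1 lerDr mulr_ge0 ?sqr_ge0 ?ltW.
apply: (@le_trans _ _ (\int[mu]_s (q s)%:E)%E).
  apply: ge0_le_integral => //.
  - by apply/measurable_EFinP; apply: measurableT_comp => //; exact: measurable_funB.
  - exact/measurable_EFinP.
  - by move=> s _; rewrite lee_fin; exact: gpq.
have -> : (\int[mu]_s (q s)%:E = (\int[mu]_s q s)%:E)%E.
  by rewrite fineK//; exact: integrable_fin_num.
rewrite lee_fin E2.
have : a * `|p ^+ 2 - \int[mu]_s (g s ^+ 2)| <= a * e ^+ 2 by rewrite ler_pM2l.
have := ler_norm (- (p ^+ 2 - \int[mu]_s (g s ^+ 2))); rewrite normrN.
have -> : a * e ^+ 2 = e / 2 by rewrite /a; field; rewrite gt_eqF.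
move=> /(ler_wpM2l (ltW a0)); lra.
Qed.

(** Averaging contracts the L^1 distance, so that the error of a truncation is
    not amplified, uniformly in [n]; a truncated function is an affine image of
    one with values in [[0, 1]]. *)
Lemma lis_avg_integrable_cvg (h : conf w0 -> R) (e : R) : 0 < e ->
  measurable_fun [set: cfg w0 `]-oo, m]] (h : cfg w0 `]-oo, m] -> R) ->
  mu.-integrable [set: cfg w0 setT] (EFin \o h) ->
  \forall n \near U, (\int[mu]_s
    `|\int[f (l n) m s]_x h x - \int[mu]_x h x|%:E <= e%:E)%E.
Proof.
move=> e0 mh hi; have e30 : 0 < e / 3 by rewrite divr_gt0.
have [N rN] := clamp_approx e30 hi.
pose D : R := N.+1%:R; have D0 : 0 < D by rewrite ltr0n.
pose u x := clamp D (h x); pose r x := h x - u x.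
pose phi x := (2 * D)^-1 * u x + 1 / 2 * cst 1 x.
have mclamp : measurable_fun [set: cfg w0 `]-oo, m]] (u : cfg w0 `]-oo, m] -> R).
  exact: (measurableT_comp (measurable_clamp _) mh).
have uD x : `|u x| <= D by apply: clamp_le; exact: ltW.
have mr : measurable_fun [set: cfg w0 `]-oo, m]] (r : cfg w0 `]-oo, m] -> R).
  exact: (measurable_funB mh mclamp).
have mphi : measurable_fun [set: cfg w0 `]-oo, m]] (phi : cfg w0 `]-oo, m] -> R).
  apply: measurable_funD; first exact: measurable_funM.
  exact: measurable_funM.
have DE : (2 * D)^-1 * D = 1 / 2 by field; rewrite gt_eqF.
have iD0 : 0 < (2 * D)^-1 by rewrite invr_gt0 mulr_gt0.
have phi01 x : 0 <= phi x <= 1.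
  have := uD x; rewrite ler_norml => /andP[/(ler_wpM2l (ltW iD0)) + /(ler_wpM2l (ltW iD0))].
  by rewrite mulrN DE /phi /=; set v := _^-1 * u x; lra.
have ui : mu.-integrable [set: cfg w0 setT] (EFin \o u).
  exact: (bounded_integrable mu1 (mfT mclamp) uD).
have ri : mu.-integrable [set: cfg w0 setT] (EFin \o r).
  by have := integrableB measurableT hi ui; apply: eq_integrable.
have e6 : 0 < e / 3 * (2 * D)^-1 by rewrite mulr_gt0.
have := lis_avg_dist_cvg e6 mphi phi01; apply: filterS => n.
set p := \int[mu]_x phi x => phip.
have [a_r ir Er lr] := lis_measure_disintegration (lm n) mr ri.
have usi s : (f (l n) m s).-integrable [set: cfg w0 `]-oo, m]] (EFin \o u).
  exact: (bounded_integrable (lis_prob f (l n) m s) mclamp uD).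
have Eu s : \int[f (l n) m s]_x phi x = (2 * D)^-1 * \int[f (l n) m s]_x u x + 1 / 2.
  have P1 := lis_prob f (l n) m s.
  have [_ ->] := Rintegral_lin2 (2 * D)^-1 (1 / 2) (usi s) (cst_integrable P1 1).
  by rewrite (Rintegral_prob_cst P1) mulr1.
have Emu : p = (2 * D)^-1 * \int[mu]_x u x + 1 / 2.
  have [_ E1] := Rintegral_lin2 (2 * D)^-1 (1 / 2) ui (cst_integrable mu1 1).
  by rewrite /p /phi E1 (Rintegral_prob_cst mu1) mulr1.
have Eh : \int[mu]_x h x = \int[mu]_x r x + \int[mu]_x u x.
  by rewrite /r RintegralB// subrK.
have mur : `|\int[mu]_x r x| <= e / 3.
  rewrite -lee_fin EFin_normr_Rintegral//; apply: le_trans rN.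
  by apply: le_abse_integral => //; apply/measurable_EFinP; exact: (mfT mr).
have mint (k : conf w0 -> R) :
    measurable_fun [set: cfg w0 `]-oo, m]] (k : cfg w0 `]-oo, m] -> R) ->
    measurable_fun [set: cfg w0 setT]
      ((fun s => \int[f (l n) m s]_x k x) : cfg w0 setT -> R).
  by move=> mk; apply: lis_integral_measurable mk.
pose A s := `|\int[f (l n) m s]_x r x|.
pose B s := `|\int[f (l n) m s]_x phi x - p|.
have A0 s : 0 <= A s by exact: normr_ge0.
have B0 s : 0 <= B s by exact: normr_ge0.
have D20 : 0 <= 2 * D by rewrite ltW// mulr_gt0.
have e30' : 0 <= e / 3 by exact: ltW.
have mA : measurable_fun [set: cfg w0 setT] (A : cfg w0 setT -> R).
  by apply: measurableT_comp; [exact: normr_measurable|exact: mint].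
have mB : measurable_fun [set: cfg w0 setT] (B : cfg w0 setT -> R).
  apply: measurableT_comp; first exact: normr_measurable.
  by apply: measurable_funB; [exact: mint|exact: measurable_cst].
have key s : (f (l n) m s).-integrable [set: cfg w0 `]-oo, m]] (EFin \o r) ->
    (`|(\int[f (l n) m s]_x h x)%R - (\int[mu]_x h x)%R|%R%:E <=
     (A s)%:E + ((2 * D)%:E * (B s)%:E + cst (e / 3)%:E s))%E.
  move=> rs; rewrite /= -EFinM -!EFinD lee_fin.
  have -> : \int[f (l n) m s]_x h x =
      \int[f (l n) m s]_x r x + \int[f (l n) m s]_x u x.
    rewrite -RintegralD//.
    by apply: eq_Rintegral => x _; rewrite /r subrK.
  have -> : 2 * D * B s = `|\int[f (l n) m s]_x u x - \int[mu]_x u x|.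
    rewrite /B Eu Emu -{1}(gtr0_norm (_ : 0 < 2 * D)) ?mulr_gt0// -normrM.
    by congr `|_|; field; rewrite gt_eqF.
  rewrite Eh opprD addrACA.
  apply: le_trans (ler_normD _ _) _; rewrite addrA addrAC lerD2r.
  by apply: le_trans (ler_normB _ _) _; rewrite lerD2l.
apply: (@le_trans _ _ (\int[mu]_s
    ((A s)%:E + ((2 * D)%:E * (B s)%:E + (cst (e / 3)%:E s))))%E).
  apply: ae_ge0_le_integral => //.
  - apply/measurable_EFinP; apply: measurableT_comp; first exact: normr_measurable.
    by apply: measurable_funB; [exact: mint|exact: measurable_cst].
  - by move=> s _; rewrite /= -EFinM -!EFinD lee_fin !addr_ge0// mulr_ge0.
  - apply: emeasurable_funD; first exact/measurable_EFinP.
    apply: emeasurable_funD => //.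
    by apply: measurable_funeM; exact/measurable_EFinP.
  - apply: (@filterS _ _ (ae_filter_ringOfSetsType mu) _ _ _ a_r) => s rs _.
    exact: key.
have mBE : measurable_fun [set: cfg w0 setT] (fun s => (2 * D)%:E * (B s)%:E)%E.
  by apply: measurable_funeM; exact/measurable_EFinP.
have B0E s : [set: cfg w0 setT] s -> (0 <= (2 * D)%:E * (B s)%:E)%E.
  by move=> _; rewrite -EFinM lee_fin mulr_ge0.
have BC0E s : [set: cfg w0 setT] s ->
    (0 <= (2 * D)%:E * (B s)%:E + cst (e / 3)%:E s)%E.
  by move=> _; apply: adde_ge0; [exact: B0E|rewrite lee_fin].
rewrite (ge0_integralD _ measurableT _ _ BC0E); last 3 first.
- by move=> s _; rewrite lee_fin.
- exact/measurable_EFinP.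
- exact: emeasurable_funD mBE (measurable_cst _).
rewrite (ge0_integralD _ measurableT B0E mBE); last 2 first.
- by move=> s _; rewrite lee_fin.
- exact: measurable_cst.
rewrite (ge0_integralZl_EFin _ measurableT); last 3 first.
- by move=> s _; rewrite lee_fin.
- exact/measurable_EFinP.
- exact: D20.
have -> : (\int[mu]_s cst (e / 3)%:E s = (e / 3)%:E)%E.
  by rewrite integral_cst// -[RHS]mule1; congr (_ * _)%E; exact: mu1.
have eE : e%:E = ((e / 3)%:E + ((2 * D)%:E * (e / 3 * (2 * D)^-1)%:E + (e / 3)%:E))%E :> \bar R.
  by rewrite -EFinM -!EFinD; congr EFin; field; rewrite gt_eqF.
rewrite eE; apply: leeD; first exact: le_trans lr rN.
apply: leeD; last exact: lexx.
apply: lee_wpmul2l; first by rewrite lee_fin.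
exact: phip.
Qed.

End left_tail.

(** * The correlation bound *)

Lemma sum_le_esum_past {R : realType} (c : int) (a : int -> \bar R) (n : nat) :
  (forall k, 0 <= a k)%E ->
  (\sum_(i < n) a (c - i%:Z)%R <= \esum_(k in [set k : int | (k <= c)%R]) a k)%E.
Proof.
move=> a0.
have e_bij : set_bij [set: nat] [set k : int | (k <= c)%R] (fun i : nat => c - i%:Z).
  split=> [k _|i j _ _|k] /=; [lia|lia|].
  by move=> kc; exists `|c - k|%N => //; lia.
rewrite (@reindex_esum _ _ _ [set: nat] _ (fun i : nat => (c - i%:Z)%R))//.
rewrite -(nneseries_esumT (a := fun i : nat => a (c - i%:Z)%R))//.
rewrite -(big_mkord xpredT (fun i : nat => a (c - i%:Z)%R)).
exact: nneseries_lim_ge.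
Qed.

Lemma product_perturbation {R : realType} (x y z a b c S eta : R) :
  0 < eta -> eta <= 1 -> `|x - y * z| <= S ->
  `|x - a| + (`|y - b| + `|z - c|) < eta ->
  `|a - b * c| <= S + eta * (2 + `|b| + `|c|).
Proof.
move=> eta0 eta1 xyz dev.
have xa := normr_ge0 (x - a); have yb := normr_ge0 (y - b).
have zc := normr_ge0 (z - c).
have -> : a - b * c = (x - y * z) - (x - a) +
    (y - b) * (z - c) + (y - b) * c + b * (z - c) by ring.
have n1 := ler_normD ((x - y * z) - (x - a) + (y - b) * (z - c) +
  (y - b) * c) (b * (z - c)).
have n2 := ler_normD ((x - y * z) - (x - a) + (y - b) * (z - c)) ((y - b) * c).
have n3 := ler_normD ((x - y * z) - (x - a)) ((y - b) * (z - c)).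
have n4 := ler_normB (x - y * z) (x - a).
rewrite !normrM in n1 n2 n3.
have d1 : `|y - b| * `|z - c| <= eta * 1 by apply: ler_pM => //; lra.
have d2 : `|y - b| * `|c| <= eta * `|c| by apply: ler_wpM2r => //; lra.
have d3 : `|b| * `|z - c| <= `|b| * eta by apply: ler_wpM2l => //; lra.
have -> : eta * (2 + `|b| + `|c|) = 2 * eta + `|b| * eta + eta * `|c| by ring.
lra.
Qed.

Unset Implicit Arguments.

Theorem theorem5p18 (R : realType) (E : metricType R)
    (dist_bounded : has_ubound (dists E))
    (Omega : set {ptws int -> E}) (w0 : Omega) (Omega_compact : compact Omega)
    (f : lis w0) (f_continuous : lis_continuous f)
    (mu : probability (cfg w0 setT) R) (mu_unique : lis_unique_measure f mu)
    (lL mL lD mD : int) (leL : lL <= mL) (leD : lD <= mD) (ltDL : mD < lL)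
    (h1 h2 : conf w0 -> R)
    (h1_Bd : Bd_on `[lL, mL] h1) (h2_Bd : Bd_on `]-oo, mD] h2)
    (h1_int : mu.-integrable [set: cfg w0 setT] (EFin \o h1))
    (h2_int : mu.-integrable [set: cfg w0 setT] (EFin \o h2))
    (h12_int : mu.-integrable [set: cfg w0 setT]
       (EFin \o (fun w => h1 w * h2 w))) :
  ((Cor mu h1 h2)%:E <=
   (diam E ^+ 2 / 4)%:E *
   \esum_(k in [set k : int | (k <= mD)%R])
     (osc `]-oo, k] k (lis_app f (k + 1) mL h1) *
      osc `]-oo, k] k (lis_app f (k + 1) mD h2)))%E.
Proof.
have [mu_lis mu_only] := mu_unique.
have cm : mD < mL by lia.
have c1m : mD + 1 <= mL by lia.
have past (n : nat) : mD + 1 - n%:Z <= mL by lia.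
have mh1 : measurable_fun [set: cfg w0 `]-oo, mL]] (h1 : cfg w0 `]-oo, mL] -> R).
  have [_] := h1_Bd; apply: cfg_measurable_fun_sub => k /=.
  by rewrite !in_itv/= => /andP[].
have mh2 : measurable_fun [set: cfg w0 `]-oo, mD]] (h2 : cfg w0 `]-oo, mD] -> R).
  by have [] := h2_Bd.
have mh2m : measurable_fun [set: cfg w0 `]-oo, mL]] (h2 : cfg w0 `]-oo, mL] -> R).
  by apply: cfg_measurable_fun_sub mh2; apply: past_sub; lia.
have mh12 : measurable_fun [set: cfg w0 `]-oo, mL]]
    ((fun w => h1 w * h2 w) : cfg w0 `]-oo, mL] -> R).
  exact: (measurable_funM mh1 mh2m).
have mu1 : mu [set: cfg w0 setT] = 1%E by exact: probability_setT.
pose term k : \bar R := (osc [set` `]-oo, k]] k (lis_app f (k + 1)%R mL h1) *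
  osc [set` `]-oo, k]] k (lis_app f (k + 1)%R mD h2))%E.
have term0 k : (0 <= term k)%E by rewrite mule_ge0// osc_ge0.
have D0 : (0 <= (diam E ^+ 2 / 4)%:E :> \bar R)%E.
  by rewrite lee_fin divr_ge0// sqr_ge0.
set S := ((diam E ^+ 2 / 4)%:E * _)%E.
have S_bound n : (\sum_(i < n) (diam E ^+ 2 / 4)%:E * term (mD - i%:Z)%R <= S)%E.
  rewrite -ge0_sume_distrr//; apply: lee_wpmul2l => //.
  exact: sum_le_esum_past.
have S0 : (0 <= S)%E.
  by apply: mule_ge0 => //; apply: esum_ge0 => k _; exact: term0.
case: S S0 S_bound => [S S0 S_bound|_ _|//]; last exact: leey.
rewrite lee_fin /Cor.
set c12 := \int[mu]_w (h1 w * h2 w); set c1 := \int[mu]_w h1 w.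
set c2 := \int[mu]_w h2 w.
apply/ler_addgt0Pr => e e0.
(* Deviations below [eta] perturb the covariance by at most [eta * K]. *)
pose K : R := 2 + `|c1| + `|c2|.
have K0 : 0 < K by rewrite /K; have := normr_ge0 c1; have := normr_ge0 c2; lra.
pose eta := Num.min 1 (e / K).
have eta0 : 0 < eta by rewrite /eta lt_min ltr01 divr_gt0.
have eta1 : eta <= 1 by rewrite /eta ge_min lexx.
have etaK : eta * K <= e by rewrite -ler_pdivlMr// /eta ge_min lexx orbT.
have eta34 : eta / 4 + (eta / 4 + eta / 4) < eta by lra.
have eta4 : 0 < eta / 4 by rewrite divr_gt0.
(* One index serves for the three functions, and then one configuration. *)
have [U [UU Uoo]] := ultraFilterLemma (F := \oo) _.
have avg h := lis_avg_integrable_cvg (h := h) mu_lis mu_only Uoo c1m eta4.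
have near1 := avg UU _ mh1 h1_int; have near2 := avg UU _ mh2m h2_int.
have near12 := avg UU _ mh12 h12_int.
have [n [[n12 n1] n2]] := filter_ex (filterI (filterI near12 near1) near2).
set l := mD + 1 - n%:Z in n12 n1 n2.
have lm : l <= mL := past n.
pose dev (h : conf w0 -> R) w := `|\int[f l mL w]_x h x - \int[mu]_x h x|.
have dev_int (h : conf w0 -> R) :
    measurable_fun [set: cfg w0 `]-oo, mL]] (h : cfg w0 `]-oo, mL] -> R) ->
    mu.-integrable [set: cfg w0 setT] (EFin \o h) ->
    (\int[mu]_w (dev h w)%:E <= (eta / 4)%:E)%E ->
    mu.-integrable [set: cfg w0 setT] (EFin \o dev h) /\
    \int[mu]_w dev h w <= eta / 4.
  move=> mh hi dh.
  have [_ hki _ _] := lis_measure_disintegration mu_lis lm mh hi.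
  have di : mu.-integrable [set: cfg w0 setT] (EFin \o dev h).
    have := integrableB measurableT hki (cst_integrable mu1 (\int[mu]_x h x)).
    by move=> /integrable_norm; apply: eq_integrable.
  by split => //; rewrite -lee_fin fineK//; exact: integrable_fin_num.
have [i12 d12] := dev_int _ mh12 h12_int n12.
have [i1 d1] := dev_int _ mh1 h1_int n1.
have [i2 d2] := dev_int _ mh2m h2_int n2.
have [a12 _ _ _] := lis_measure_disintegration mu_lis lm mh12 h12_int.
have [a1 _ _ _] := lis_measure_disintegration mu_lis lm mh1 h1_int.
have [a2 _ _ _] := lis_measure_disintegration mu_lis lm mh2m h2_int.
have [j1 e1] := Rintegral_lin2 1 1 i1 i2.
have [j2 e2] := Rintegral_lin2 1 1 i12 j1.
rewrite e1 in e2.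
have [] := @ae_exists_lt _ _ _ _ mu1
  (fun w => [/\ (f l mL w).-integrable [set: cfg w0 `]-oo, mL]] (EFin \o h1),
    (f l mL w).-integrable [set: cfg w0 `]-oo, mL]] (EFin \o h2) &
    (f l mL w).-integrable [set: cfg w0 `]-oo, mL]] (EFin \o (fun w => h1 w * h2 w))])
  _ eta j2.
- by move=> w; rewrite !mul1r !addr_ge0 ?normr_ge0.
- by apply: (@filterS3 _ _ (ae_filter_ringOfSetsType mu) _ _ _ _ _ a1 a2 a12) => w.
- rewrite e2 !mul1r; apply: le_lt_trans eta34.
  exact: (lerD d12 (lerD d1 d2)).
move=> w [wint]; rewrite !mul1r /dev -/c12 -/c1 -/c2.
have := finite_volume_covariance dist_bounded cm mh1 mh2 wint.
move=> /le_trans /(_ (S_bound n)); rewrite lee_fin -/l.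
set x := \int[f l mL w]_x (h1 x * h2 x); set y := \int[f l mL w]_x h1 x.
set z := \int[f l mL w]_x h2 x.
move=> cov dev_lt.
apply: le_trans (product_perturbation eta0 eta1 cov dev_lt) _.
by rewrite lerD2l.
Qed.
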